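(* There exists a compact $6$-dimensional smooth manifold $M$ admitting a symplectic half-flat structure $(\omega,J,\psi)$ such that $[\mathrm{Re}\,\psi]=0$ in the de Rham cohomology group $H^3(M,\mathbb{R})$, i.e. such that the closed $3$-form $\mathrm{Re}\,\psi$ is $d$-exact.
   Context: An $\mathrm{SU}(3)$-structure on a $6$-dimensional smooth manifold $M$ is a triple $(\omega,J,\psi)$ where: $\omega$ is a non-degenerate $2$-form on $M$; $J$ is an $\omega$-calibrated almost complex structure on $M$, i.e. an almost complex structure such that $g_J(\cdot,\cdot)=\omega(\cdot,J\cdot)$ is an almost Hermitian metric (a $J$-invariant Riemannian metric); and $\psi$ is a nowhere vanishing complex form of type $(3,0)$ with respect to $J$ satisfying $\psi\wedge\overline{\psi}=-\frac{4}{3}i\,\omega^3$. The $\mathrm{SU}(3)$-structure is called symplectic half-flat if $d\omega=0$ and $d(\mathrm{Re}\,\psi)=0$. Compact manifolds are without boundary. *)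

(* Defs.v *)
From mathcomp Require Import all_boot all_order all_algebra all_fingroup.
From mathcomp Require Import all_classical all_reals all_analysis.
From mathcomp Require Import complex.

Set Implicit Arguments.
Unset Strict Implicit.
Unset Printing Implicit Defensive.

Import Order.TTheory GRing.Theory Num.Theory.
Import numFieldNormedType.Exports.

Local Open Scope classical_set_scope.
Local Open Scope ring_scope.

Section Smooth.
Variables (R : realType) (n : nat) (W : normedModType R).

Definition partial (i : 'I_n) (f : 'rV[R]_n -> W) : 'rV[R]_n -> W :=
  fun x => 'D_(delta_mx 0 i) f x.

(* C^oo on V: every iterated partial derivative, including f itself, is
   (Frechet-)differentiable at every point of V.  Meant for open V only. *)
Definition smooth_on (V : set 'rV[R]_n) (f : 'rV[R]_n -> W) : Prop :=
  forall (s : seq 'I_n) (x : 'rV[R]_n), V x -> differentiable (foldr partial f s) x.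

End Smooth.

Section Manifold.
Variables (R : realType) (n : nat).

(* A homeomorphism between an open subset of M and an open subset of R^n; both
   maps are total functions whose values outside these sets are irrelevant. *)
Record chart (M : topologicalType) := Chart {
  chart_dom : set M;
  chart_cod : set 'rV[R]_n;
  chart_map : M -> 'rV[R]_n;
  chart_inv : 'rV[R]_n -> M;
  chart_dom_open : open chart_dom;
  chart_cod_open : open chart_cod;
  chart_mapP : forall p, chart_dom p -> chart_cod (chart_map p);
  chart_invP : forall x, chart_cod x -> chart_dom (chart_inv x);
  chart_mapK : forall p, chart_dom p -> chart_inv (chart_map p) = p;
  chart_invK : forall x, chart_cod x -> chart_map (chart_inv x) = x;
  chart_map_cont : {within chart_dom, continuous chart_map};
  chart_inv_cont : {within chart_cod, continuous chart_inv}
}.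

(* The domain, in the coordinates of c, and the formula of the change of
   coordinates from c to c'. *)
Definition overlap (M : topologicalType) (c c' : chart M) : set 'rV[R]_n :=
  [set x | chart_cod c x /\ chart_dom c' (chart_inv c x)].

Definition transition (M : topologicalType) (c c' : chart M) :
    'rV[R]_n -> 'rV[R]_n :=
  fun x => chart_map c' (chart_inv c x).

Record smoothManifold := SmoothManifold {
  carrier :> topologicalType;
  carrier_hausdorff : hausdorff_space carrier;
  carrier_second_countable : @second_countable carrier;
  atlas_index : Type;
  atlas : atlas_index -> chart carrier;
  atlas_cover : forall p : carrier, exists i, chart_dom (atlas i) p;
  atlas_smooth : forall i j,
    smooth_on (overlap (atlas i) (atlas j)) (transition (atlas i) (atlas j))
}.

End Manifold.

Section LinearAlgebra.
Variables (R : realType) (n : nat).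

(* The k arguments of a k-linear form on R^n are the rows of a k x n matrix;
   compare determinant_multilinear and determinant_alternate. *)
Definition kform (A : Type) (k : nat) := 'M[R]_(k, n) -> A.

Definition multilinear k (a : kform R k) : Prop :=
  forall (v u w : 'M[R]_(k, n)) (i : 'I_k) (b c : R),
    row i v = b *: row i u + c *: row i w ->
    row' i u = row' i v -> row' i w = row' i v ->
    a v = b * a u + c * a w.

Definition alternate k (a : kform R k) : Prop :=
  forall (v : 'M[R]_(k, n)) (i j : 'I_k), i != j -> row i v = row j v -> a v = 0.

(* The normalization for which e1 /\ ... /\ en is the determinant. *)
Definition wedge (A : fieldType) p q (a : kform A p) (b : kform A q) :
    kform A (p + q) :=
  fun v => (p`! * q`!)%:R^-1 *
    \sum_(s : 'S_(p + q))
      (-1) ^+ s * a (usubmx (row_perm s v)) * b (dsubmx (row_perm s v)).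

(* a vanishes as soon as one of its arguments is a vector u + i J u of type
   (0,1), that is, a is of type (k,0).  J acts on row vectors on the right. *)
Definition type_k0 k (J : 'M[R]_n) (a : kform R[i] k) : Prop :=
  forall (v : 'M[R]_(k, n)) (j : 'I_k),
    a v + 'i%C *
      a (\matrix_(l < k) (if l == j then row l v *m J else row l v)) = 0.

End LinearAlgebra.

Section Forms.
Variables (R : realType) (n : nat) (M : smoothManifold R n).

Local Notation cod i := (chart_cod (@atlas R n M i)).
Local Notation overl i j := (overlap (@atlas R n M i) (@atlas R n M j)).
Local Notation trans i j := (transition (@atlas R n M i) (@atlas R n M j)).

(* Tensor fields are given by their local expressions in the charts of the
   atlas; in chart i only the values at points of cod i are meaningful. *)
Definition local_form (A : Type) (k : nat) :=
  atlas_index M -> 'rV[R]_n -> kform R n A k.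

(* Real differential k-forms: smooth, alternating, and invariant under
   pullback along the changes of coordinates ('J is the Jacobian matrix, acting
   on row vectors on the right). *)
Definition diff_form k (a : local_form R k) : Prop :=
  [/\ forall i x, cod i x -> multilinear (a i x),
      forall i x, cod i x -> alternate (a i x),
      forall i v, smooth_on (cod i) (fun x => a i x v)
    & forall i j x v, overl i j x ->
        a i x v = a j (trans i j x) (v *m 'J (trans i j) x)].

Definition re_form k (a : local_form R[i] k) : local_form R k :=
  fun i x v => complex.Re (a i x v).

Definition im_form k (a : local_form R[i] k) : local_form R k :=
  fun i x v => complex.Im (a i x v).

Definition complex_diff_form k (a : local_form R[i] k) : Prop :=
  diff_form (re_form a) /\ diff_form (im_form a).

(* d a (v_0, ..., v_k) = sum_j (-1)^j D_{v_j} (a (v_0, ..., ^v_j, ..., v_k)),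
   for constant vectors v_0, ..., v_k of R^n. *)
Definition ext_d k (a : local_form R k) : local_form R k.+1 :=
  fun i x v => \sum_(j < k.+1)
    (-1) ^+ j * 'D_(row j v) (fun y => a i y (row' j v)) x.

Definition closed_form k (a : local_form R k) : Prop :=
  forall i x v, cod i x -> ext_d a i x v = 0.

Definition exact_form k (a : local_form R k.+1) : Prop :=
  exists2 b : local_form R k, diff_form b &
    forall i x v, cod i x -> a i x v = ext_d b i x v.

Definition nondegenerate (w : local_form R 2) : Prop :=
  forall i x (u : 'rV[R]_n), cod i x ->
    (forall v : 'rV[R]_n, w i x (col_mx u v) = 0) -> u = 0.

(* J X is the row vector X *m J i x in chart i. *)
Definition almost_complex (J : atlas_index M -> 'rV[R]_n -> 'M[R]_n) : Prop :=
  [/\ forall i a b, smooth_on (cod i) (fun x => J i x a b),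
      forall i j x, overl i j x ->
        J i x *m 'J (trans i j) x = 'J (trans i j) x *m J j (trans i j x)
    & forall i x, cod i x -> J i x *m J i x = - 1%:M].

Definition metric_of (w : local_form R 2)
    (J : atlas_index M -> 'rV[R]_n -> 'M[R]_n) i x (u v : 'rV[R]_n) : R :=
  w i x (col_mx u (v *m J i x)).

Definition almost_hermitian (J : atlas_index M -> 'rV[R]_n -> 'M[R]_n)
    (g : atlas_index M -> 'rV[R]_n -> 'rV[R]_n -> 'rV[R]_n -> R) : Prop :=
  forall i x, cod i x ->
    [/\ forall u v, g i x u v = g i x v u,
        forall u, u != 0 -> 0 < g i x u u
      & forall u v, g i x (u *m J i x) (v *m J i x) = g i x u v].

Definition calibrated (w : local_form R 2)
    (J : atlas_index M -> 'rV[R]_n -> 'M[R]_n) : Prop :=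
  almost_hermitian J (metric_of w J).

Definition nowhere_vanishing k (a : local_form R[i] k) : Prop :=
  forall i x, cod i x -> exists v, a i x v != 0.

End Forms.

Section SU3.
Variables (R : realType) (M : smoothManifold R 6).

(* The last clause is psi /\ conj psi = - (4/3) i w^3. *)
Definition SU3_structure (w : local_form M R 2)
    (J : atlas_index M -> 'rV[R]_6 -> 'M[R]_6) (psi : local_form M R[i] 3) :
    Prop :=
  [/\ diff_form w /\ nondegenerate w,
      almost_complex J /\ calibrated w J,
      complex_diff_form psi /\ nowhere_vanishing psi,
      forall i x, chart_cod (atlas i) x -> type_k0 (J i x) (psi i x)
    & forall i x (v : 'M[R]_(6, 6)), chart_cod (atlas i) x ->
        wedge (psi i x) (fun u => (psi i x u)^*%C) v =
        - (4 / 3) * 'i%C * (wedge (wedge (w i x) (w i x)) (w i x) v)%:C%C].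

Definition symplectic_half_flat (w : local_form M R 2)
    (J : atlas_index M -> 'rV[R]_6 -> 'M[R]_6) (psi : local_form M R[i] 3) :
    Prop :=
  [/\ SU3_structure w J psi, closed_form w & closed_form (re_form psi)].

End SU3.

(* Main.v *)
(** The manifold is a product of two compact quotients of the solvable group
    Sol, the semidirect product of R acting on R^2 by diag(e^t, e^-t).  On
    Sol x Sol take the coframe dt, ds, e^t dx_1, e^-t dy_1, e^s dx_2, e^-s dy_2,
    and let psi = (1 - i) zeta_0 /\ zeta_1 /\ zeta_2, where zeta_0 = dt + i ds,
    zeta_1 = e^t dx_1 + (i/2) e^-t dy_1 and zeta_2 = e^s dx_2 + i e^-s dy_2.
    The form omega = dt /\ ds + dx_1 /\ dy_1 + dx_2 /\ dy_2 is invariant with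
    constant coefficients, hence closed.  Every two-form
    e^(+-t +-s) du /\ dv with u in {x_1, y_1}, v in {x_2, y_2} and the matching
    signs is invariant and has d = (+-dt +-ds) /\ itself; the combination
    [sol_primitive_terms] of these four forms is chosen so that its differential
    is Re psi.  The lattice comes from Z[sqrt 3], on which the unit 2 + sqrt 3
    acts with eigenvalues e^c and e^-c, c = ln (2 + sqrt 3). *)

Require Import Defs.
From mathcomp Require Import all_boot all_order all_algebra all_fingroup.
From mathcomp Require Import all_classical all_reals all_analysis.
From mathcomp Require Import complex.
From mathcomp Require Import ring lra.

Set Implicit Arguments.
Unset Strict Implicit.
Unset Printing Implicit Defensive.

Import Order.TTheory GRing.Theory Num.Theory.
Import numFieldNormedType.Exports.

Local Open Scope classical_set_scope.
Local Open Scope ring_scope.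

(** * Wedge products of determinant forms *)

(** Put a_1 = e^t dx_1, b_1 = e^-t dy_1, a_2 = e^s dx_2, b_2 = e^-s dy_2. The phase 1 - i is what
    makes Re psi exact. The real and imaginary parts of (1 - i)(dt + i ds) are dt + ds and ds - dt;
    up to sign, these are the one-forms by which d multiplies the products standing beside them in
    Re psi, namely a_1 a_2, b_1 b_2 for the first and a_1 b_2, b_1 a_2 for the second. With phase 1,
    Re psi would contain dt /\ a_1 /\ a_2, which is not a multiple of d(a_1 /\ a_2). As |1 - i|^2 =
    2, the volume condition calls for a compensating factor 1/2; placed on b_1, it keeps all
    constants rational. The charts are local sections of the projection from R^6, so a
    lattice-invariant tensor on R^6 has the same expression in all of them. All forms are
    determinants with exponential coefficients, on which d acts formally and the wedge product
    concatenates columns. *)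

Section DirectSumPerm.
Variables p q : nat.

Definition dsum_perm_fun (s : 'S_p) (t : 'S_q) (k : 'I_(p + q)) : 'I_(p + q) :=
  match fintype.split k with inl i => lshift q (s i) | inr j => rshift p (t j) end.

Lemma dsum_perm_inj s t : injective (dsum_perm_fun s t).
Proof.
move=> k l; rewrite /dsum_perm_fun.
case: split_ordP => i ->; case: split_ordP => j ->.
- by move/lshift_inj/perm_inj->.
- by move/eqP; rewrite eq_lrshift.
- by move/eqP; rewrite eq_rlshift.
- by move/rshift_inj/perm_inj->.
Qed.

Definition dsum_perm s t : 'S_(p + q) := perm (@dsum_perm_inj s t).

Lemma dsum_permEl s t i : dsum_perm s t (lshift q i) = lshift q (s i).
Proof. by rewrite permE /dsum_perm_fun (unsplitK (inl i)). Qed.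

Lemma dsum_permEr s t j : dsum_perm s t (rshift p j) = rshift p (t j).
Proof. by rewrite permE /dsum_perm_fun (unsplitK (inr j)). Qed.

(** The sign is the determinant of the permutation matrix, which is block diagonal here. *)
Lemma sign_dsum_perm (K : comNzRingType) s t :
  (-1) ^+ dsum_perm s t = (-1) ^+ s * (-1) ^+ t :> K.
Proof.
rewrite -!det_perm -(det_ublock _ 0); congr (\det _); apply/matrixP => k l.
rewrite !mxE; case: (split_ordP k) => i ->; rewrite !mxE;
  case: (split_ordP l) => j ->; rewrite !mxE ?dsum_permEl ?dsum_permEr.
- by rewrite (inj_eq (@lshift_inj _ _)).
- by rewrite eq_lrshift.
- by rewrite eq_rlshift.
- by rewrite (inj_eq (@rshift_inj _ _)).
Qed.

End DirectSumPerm.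

(* Expanding both minors, the sum over [s] attached to a pair of permutations
   of the two column blocks is the determinant of a column permutation of N. *)
Lemma sum_det_minors (K : comNzRingType) p q (N : 'M[K]_(p + q)) :
  \sum_(s : 'S_(p + q)) (-1) ^+ s * \det (ulsubmx (row_perm s N)) *
    \det (drsubmx (row_perm s N)) = (p`! * q`!)%:R * \det N.
Proof.
pose F (s : 'S_(p + q)) (t : 'S_p * 'S_q) : K :=
  (-1) ^+ s * ((-1) ^+ t.1 * (-1) ^+ t.2) *
    \prod_k N (s k) (dsum_perm t.1 t.2 k).
transitivity (\sum_s \sum_t F s t).
  apply: eq_bigr => s _; rewrite -(pair_bigA _ (fun t1 t2 => F s (t1, t2))) /=.
  rewrite /determinant -mulrA mulr_suml mulr_sumr.
  apply: eq_bigr => t1 _; rewrite !mulr_sumr; apply: eq_bigr => t2 _.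
  rewrite /F /= big_split_ord /=.
  under [X in _ = _ * (X * _)]eq_bigr => i _ do rewrite dsum_permEl.
  under [X in _ = _ * (_ * X)]eq_bigr => i _ do rewrite dsum_permEr.
  under [X in _ * (_ * X * _) = _]eq_bigr => i _ do rewrite !mxE.
  under [X in _ * (_ * (_ * X)) = _]eq_bigr => i _ do rewrite !mxE.
  by rewrite mulrACA !mulrA.
rewrite exchange_big /=.
under eq_bigr => t _.
  have -> : \sum_s F s t = \det N.
    transitivity ((-1) ^+ dsum_perm t.1 t.2 *
        \det (row_perm (dsum_perm t.1 t.2) N^T)).
      rewrite sign_dsum_perm mulr_sumr; apply: eq_bigr => s _.
      rewrite /F -mulrA mulrCA; congr (_ * (_ * _)).
      by apply: eq_bigr => k _; rewrite !mxE.
    by rewrite row_permE det_mulmx det_perm det_tr signrMK.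
  over.
by rewrite sumr_const cardE -cardT card_prod !card_Sn mulr_natl.
Qed.

Section DeterminantForms.
Variables (R : realType) (K : numFieldType) (f : {rmorphism R -> K}) (n : nat).

(** The vectors stay real while the columns of [A] may be complex: [f] is the identity for real
    forms and the embedding into R[i] for psi. *)
Definition det_form p (A : 'M[K]_(n, p)) : kform R n K p :=
  fun u => \det (map_mx f u *m A).

(** Permuting the rows of [v] permutes those of [N], so the sum defining the wedge runs over
    products of complementary minors of [N]: this is the generalized Laplace expansion. *)
Lemma wedge_det_form p q (A : 'M[K]_(n, p)) (B : 'M[K]_(n, q)) v :
  wedge (det_form A) (det_form B) v = det_form (row_mx A B) v.
Proof.
rewrite /wedge; set N := map_mx f v *m row_mx A B.
rewrite (eq_bigr (fun s : 'S_(p + q) => (-1) ^+ s *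
    \det (ulsubmx (row_perm s N)) * \det (drsubmx (row_perm s N)))); last first.
  move=> s _; rewrite /det_form /N row_permE -(map_perm_mx f).
  rewrite mulmxA -map_mxM -row_permE -[row_perm s v in RHS]vsubmxK map_col_mx.
  by rewrite mul_col_row block_mxKul block_mxKdr.
by rewrite sum_det_minors mulKf // pnatr_eq0 muln_eq0 -!lt0n !fact_gt0.
Qed.

End DeterminantForms.

(** * Smoothness of exponential sums *)

Section AffineMaps.
Variables (R : realType) (n m : nat).
Implicit Types (A : 'M[R]_(n, m)) (x : 'rV[R]_n).

Lemma differentiable_mulmx A x :
  differentiable (fun y : 'rV[R]_n => y *m A : 'rV[R]_m) x.
Proof.
have -> : (fun y : 'rV[R]_n => y *m A) =
    \sum_i (fun y : 'rV[R]_n => y 0 i *: row i A).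
  by apply/funext => y; rewrite fct_sumE mulmx_sum_row.
by apply: differentiable_sum => i; exact/differentiableZl/differentiable_coord.
Qed.

Lemma differentiable_affine A (b : 'rV[R]_m) x :
  differentiable (fun y : 'rV[R]_n => y *m A + b) x.
Proof.
by apply: differentiableD; [exact: differentiable_mulmx|exact: differentiable_cst].
Qed.

Lemma derive_affine A (b : 'rV[R]_m) x v :
  'D_v (fun y : 'rV[R]_n => y *m A + b) x = v *m A.
Proof.
have dA := differentiable_mulmx A x; have db := @differentiable_cst R _ _ b x.
have -> : (fun y : 'rV[R]_n => y *m A + b) = mulmxr A \+ cst b by [].
rewrite deriveD; [|exact: diff_derivable..].
rewrite derive_cst addr0 deriveE // (@diff_lin _ _ _ (mulmxr A)) //.
by move=> y; exact/differentiable_continuous/differentiable_mulmx.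
Qed.

End AffineMaps.

Section Locality.
Variables (R : numFieldType) (V W : normedModType R).

(** The first-order expansion of [g] at [x] is also one of [f], and expansions are unique. This
    serves transition maps, which agree with an affine map only near each point. *)
Lemma near_eq_diff (f g : V -> W) x : differentiable g x ->
  {near x, f =1 g} -> differentiable f x /\ 'd f x = 'd g x :> (V -> W).
Proof.
move=> dg fg; have [cg gE] := (diff_locallyP _ _).1 dg.
have fE : f \o shift x = cst (f x) + 'd g x +o_ 0 id.
  have fgx := nbhs_singleton fg.
  apply/eqaddoP => e e0; move: gE => /eqaddoP /(_ e e0).
  have fg0 : \forall y \near 0, f (y + x) = g (y + x).
    by move: fg; rewrite (near_shift 0 x) subr0.
  by apply: filterS2 fg0 => y fgy; rewrite /= !fctE /= fgy fgx.
have dfg : 'd f x = 'd g x :> (V -> W) by exact: diff_unique.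
have [_] := diff_locallyP x f; rewrite dfg => dfP.
by split; first exact: (dfP (conj cg fE)).
Qed.

End Locality.

Section Smoothness.
Variables (R : realType) (n : nat).
Implicit Type V : set 'rV[R]_n.

Lemma smooth_on_local (W : normedModType R) V (f : 'rV[R]_n -> W) :
  (forall x, V x -> exists g : 'rV[R]_n -> W,
      smooth_on [set: 'rV[R]_n] g /\ {near x, f =1 g}) ->
  smooth_on V f.
Proof.
move=> fg s x /fg[g [gs fgx]].
suff fgs : {near x, foldr (@partial R n W) f s =1 foldr (@partial R n W) g s}.
  by have [] := near_eq_diff (gs s x I) fgs.
elim: s => //= i s IH.
(* Differentiating at [y] requires equality on a neighborhood of [y], and this holds for all [y]
   near [x]. *)
apply: filterS (near_join IH) => y IHy.
exact: near_eq_derive.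
Qed.

Lemma smooth_affine (A : 'M[R]_n) (b : 'rV[R]_n) V :
  smooth_on V (fun x => x *m A + b).
Proof.
move=> s x _.
suff [C [d ->]] : exists C d,
    foldr (@partial R n _) (fun x => x *m A + b) s = (fun x => x *m C + d).
  exact: differentiable_affine.
elim: s => [|i s [C [d IH]]]; first by exists A, b.
exists 0, (delta_mx 0 i *m C); apply/funext => y /=.
by rewrite /partial IH derive_affine mulmx0 add0r.
Qed.

Lemma differentiable_linear_form (l : 'cV[R]_n) x :
  differentiable (fun y : 'rV[R]_n => (y *m l) 0 0) x.
Proof.
apply: (@differentiable_comp _ _ _ _ (fun y : 'rV[R]_n => y *m l)
  (fun M : 'M[R]_1 => M 0 0)); first exact: differentiable_mulmx.
exact: differentiable_coord.
Qed.

Lemma derive_linear_form (l : 'cV[R]_n) x v :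
  'D_v (fun y : 'rV[R]_n => (y *m l) 0 0) x = (v *m l) 0 0.
Proof.
have := derive_affine l 0 x v; rewrite derive_mx; last first.
  exact/diff_derivable/differentiable_affine.
move/matrixP/(_ 0 0); rewrite mxE => <-.
by congr ('D_v _ x); apply/funext => y; rewrite addr0.
Qed.

Lemma differentiable_expR_linear (l : 'cV[R]_n) x :
  differentiable (fun y : 'rV[R]_n => expR ((y *m l) 0 0)) x.
Proof.
apply: (@differentiable_comp _ _ _ _ (fun y : 'rV[R]_n => (y *m l) 0 0) expR).
  exact: differentiable_linear_form.
exact/derivable1_diffP/derivable_expR.
Qed.

Lemma derive_expR_linear (l : 'cV[R]_n) x v :
  'D_v (fun y : 'rV[R]_n => expR ((y *m l) 0 0)) x =
  (v *m l) 0 0 * expR ((x *m l) 0 0).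
Proof.
have de : differentiable (@expR R) ((x *m l) 0 0).
  exact/derivable1_diffP/derivable_expR.
have dl := differentiable_linear_form l x.
rewrite deriveE; last exact: differentiable_expR_linear.
rewrite (@diff_comp _ _ _ _ (fun y : 'rV[R]_n => (y *m l) 0 0) expR) //=.
(* The differential of [expR] at a point is a linear map on R, so its value at 1 determines it. *)
rewrite -(deriveE _ dl) derive_linear_form -[(v *m l) 0 0 in LHS]mulr1.
by rewrite -[_ * 1]/(_ *: (1 : R^o)) linearZ /= -(deriveE _ de) derive_val.
Qed.

(** A class of differentiable functions closed under sums, products and partial derivatives, so that
    membership alone yields smoothness. *)
Definition exp_sum (f : 'rV[R]_n -> R) :=
  exists s : seq (R * 'cV[R]_n),
    f = fun x => \sum_(p <- s) p.1 * expR ((x *m p.2) 0 0).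

Lemma exp_sum_cst c : exp_sum (cst c).
Proof.
by exists [:: (c, 0)]; apply/funext => x; rewrite big_seq1 mulmx0 mxE expR0 mulr1.
Qed.

Lemma exp_sum_expR (l : 'cV[R]_n) : exp_sum (fun x => expR ((x *m l) 0 0)).
Proof. by exists [:: (1, l)]; apply/funext => x; rewrite big_seq1 mul1r. Qed.

Lemma exp_sumD f g : exp_sum f -> exp_sum g -> exp_sum (fun x => f x + g x).
Proof.
move=> [s ->] [t ->]; exists (s ++ t); apply/funext => x.
by rewrite big_cat.
Qed.

Lemma exp_sumM f g : exp_sum f -> exp_sum g -> exp_sum (fun x => f x * g x).
Proof.
move=> [s ->] [t ->].
exists [seq (p.1 * q.1, p.2 + q.2) | p <- s, q <- t]; apply/funext => x.
rewrite big_allpairs_dep mulr_suml; apply: eq_bigr => p _.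
rewrite mulr_sumr; apply: eq_bigr => q _ /=.
by rewrite mulrACA mulmxDr [in RHS]mxE expRD.
Qed.

Lemma exp_sumN f : exp_sum f -> exp_sum (fun x => - f x).
Proof.
move=> fE; have -> : (fun x => - f x) = (fun x => cst (-1) x * f x).
  by apply/funext => x; rewrite mulN1r.
by apply: exp_sumM => //; exact: exp_sum_cst.
Qed.

Lemma exp_sum_sum I (r : seq I) (F : I -> 'rV[R]_n -> R) :
  (forall i, exp_sum (F i)) -> exp_sum (fun x => \sum_(i <- r) F i x).
Proof.
move=> FE; elim: r => [|i r IH].
  by under eq_fun do rewrite big_nil; exact: exp_sum_cst.
by under eq_fun do rewrite big_cons; exact: exp_sumD.
Qed.

Lemma exp_sum_differentiable f x : exp_sum f -> differentiable f x.
Proof.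
case=> s ->; elim: s => [|p s IH].
  by under eq_fun do rewrite big_nil; exact: differentiable_cst.
under eq_fun do rewrite big_cons; apply: differentiableD => //.
apply: differentiableM; first exact: differentiable_cst.
exact: differentiable_expR_linear.
Qed.

Lemma exp_sum_partial i f : exp_sum f -> exp_sum (partial i f).
Proof.
case=> s ->; exists [seq (p.1 * (p.2 : 'cV_n) i 0, p.2) | p <- s]; apply/funext => x.
rewrite /partial big_map /=; elim: s => [|p s IH].
  by under eq_fun do rewrite big_nil; rewrite derive_cst big_nil.
rewrite big_cons -IH.
under [X in 'D__ X _ = _]eq_fun do rewrite big_cons.
have dp := @differentiable_expR_linear p.2 x.
rewrite deriveD.
- congr (_ + _); rewrite deriveZ; last exact: diff_derivable.
  by rewrite derive_expR_linear -rowE mxE -[LHS]/(_ * (_ * _)) mulrA.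
- apply: diff_derivable; apply: differentiableM => //; exact: differentiable_cst.
- by apply: diff_derivable; apply: exp_sum_differentiable; exists s.
Qed.

Lemma exp_sum_smooth V f : exp_sum f -> smooth_on V f.
Proof.
move=> fE s x _; apply: exp_sum_differentiable.
by elim: s => //= i s; exact: exp_sum_partial.
Qed.

End Smoothness.

(** * Forms with exponential coefficients *)

Lemma row'_mul (K : pzSemiRingType) m p q (i : 'I_m) (v : 'M[K]_(m, p))
    (A : 'M[K]_(p, q)) :
  row' i (v *m A) = row' i v *m A.
Proof. by apply/matrixP => a b; rewrite !mxE; apply: eq_bigr => c _; rewrite !mxE. Qed.

Section ExpDetForms.
Variables (R : realType) (n : nat).

(** Since [1 + p] and [p.+1] are convertible, the block matrix can be indexed by [ord0] and
    [lift ord0], as Laplace expansion requires. *)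
Lemma row_mx_col0 p (l : 'cV[R]_n) (C : 'M[R]_(n, p)) a :
  (row_mx l C : 'M[R]_(n, 1 + p)) a ord0 = l a 0.
Proof.
have -> : ord0 = lshift p (0 : 'I_1) by exact/val_inj.
by rewrite row_mxEl.
Qed.

Lemma row_mx_lift0 p (l : 'cV[R]_n) (C : 'M[R]_(n, p)) a b :
  (row_mx l C : 'M[R]_(n, 1 + p)) a (lift ord0 b) = C a b.
Proof.
have -> : lift ord0 b = rshift 1 b by exact/val_inj.
by rewrite row_mxEr.
Qed.

Lemma multilinear_det p (C : 'M[R]_(n, p)) :
  multilinear (fun v : 'M[R]_(p, n) => \det (v *m C)).
Proof.
move=> v u w i b c vE uE wE; apply: (determinant_multilinear (i0 := i)).
- by rewrite !row_mul vE mulmxDl !scalemxAl.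
- by rewrite !row'_mul uE.
- by rewrite !row'_mul wE.
Qed.

Lemma alternate_det p (C : 'M[R]_(n, p)) :
  alternate (fun v : 'M[R]_(p, n) => \det (v *m C)).
Proof.
move=> v i j ij vij; apply: (determinant_alternate ij) => k.
by move/rowP/(_ k): (congr1 (mulmx^~ C) vij); rewrite -!row_mul !mxE.
Qed.

(* The p-form [\sum c e^l C_1 /\ ... /\ C_p] over the triples ((c, l), C) in s,
   where the columns l, C_1, ..., C_p are linear forms on R^n. *)
Definition exp_det_form p (s : seq (R * 'cV[R]_n * 'M[R]_(n, p))) :
    'rV[R]_n -> kform R n R p :=
  fun x v => \sum_(t <- s) t.1.1 * (expR ((x *m t.1.2) 0 0) * \det (v *m t.2)).

(** As d(e^l) = e^l l and the C_i are constant, d only puts the column l in front. *)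
Definition d_terms p (s : seq (R * 'cV[R]_n * 'M[R]_(n, p))) :
    seq (R * 'cV[R]_n * 'M[R]_(n, p.+1)) :=
  [seq (t.1, (row_mx t.1.2 t.2 : 'M[R]_(n, 1 + p))) | t : R * 'cV[R]_n * 'M[R]_(n, p) <- s].

Lemma multilinear_exp_det_form p s x : multilinear (@exp_det_form p s x).
Proof.
move=> v u w i b c vE uE wE; rewrite /exp_det_form !mulr_sumr -big_split /=.
apply: eq_bigr => t _; rewrite (multilinear_det t.2 vE uE wE).
by rewrite !mulrDr; congr (_ + _); rewrite !(mulrCA b, mulrCA c).
Qed.

Lemma alternate_exp_det_form p s x : alternate (@exp_det_form p s x).
Proof.
move=> v i j ij vij; apply: big1 => t _.
by rewrite (alternate_det t.2 ij vij) !mulr0.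
Qed.

Lemma exp_sum_exp_det_form p s v : exp_sum (fun x => @exp_det_form p s x v).
Proof.
apply: exp_sum_sum => t; apply: exp_sumM; first exact: exp_sum_cst.
by apply: exp_sumM; [exact: exp_sum_expR|exact: exp_sum_cst].
Qed.

(* The definition of [ext_d] is the Laplace expansion of the determinants
   [\det (v *m row_mx l C)] along their first column. *)
Lemma ext_d_exp_det_form (M : smoothManifold R n) p s i x v :
  ext_d (fun _ : atlas_index M => @exp_det_form p s) i x v =
  exp_det_form (d_terms s) x v.
Proof.
have D u w : 'D_u (fun y => @exp_det_form p s y w) x =
    \sum_(t <- s) t.1.1 *
      ((u *m t.1.2) 0 0 * (expR ((x *m t.1.2) 0 0) * \det (w *m t.2))).
  rewrite /exp_det_form; elim: s => [|t s IH].
    by under eq_fun do rewrite big_nil; rewrite derive_cst big_nil.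
  rewrite big_cons -IH.
  under [X in 'D__ X _ = _]eq_fun do rewrite big_cons.
  have E y : t.1.1 * (expR ((y *m t.1.2) 0 0) * \det (w *m t.2)) =
      (t.1.1 * \det (w *m t.2)) * expR ((y *m t.1.2) 0 0).
    by rewrite mulrCA mulrC.
  under [X in 'D__ X _ = _]eq_fun do rewrite E.
  have dt := @differentiable_expR_linear _ _ t.1.2 x.
  rewrite deriveD.
  - congr (_ + _); rewrite deriveZ; last exact: diff_derivable.
    by rewrite derive_expR_linear -[LHS]/(_ * (_ * _)) mulrCA -E mulrCA.
  - apply: diff_derivable; apply: differentiableM => //; exact: differentiable_cst.
  - by apply: diff_derivable; apply: exp_sum_differentiable; exact: exp_sum_exp_det_form.
rewrite /ext_d; under eq_bigr do rewrite D mulr_sumr.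
rewrite /exp_det_form big_map.
rewrite exchange_big /=; apply: eq_bigr => t _.
rewrite (expand_det_col _ ord0) !mulr_sumr; apply: eq_bigr => j _.
rewrite /cofactor addn0.
have -> : (v *m (row_mx t.1.2 t.2 : 'M[R]_(n, 1 + p))) j ord0 =
    (row j v *m t.1.2) 0 0.
  rewrite !mxE; apply: eq_bigr => a _.
  by rewrite row_mx_col0 mxE.
have -> : row' j (col' ord0 (v *m (row_mx t.1.2 t.2 : 'M[R]_(n, 1 + p)))) =
    row' j v *m t.2.
  apply/matrixP => a b; rewrite !mxE; apply: eq_bigr => c _.
  by rewrite row_mx_lift0 mxE.
by ring.
Qed.

(** Both applications of d prepend the same column l, so each determinant has two equal columns. *)
Lemma ext_d2_exp_det_form p (s : seq (R * 'cV[R]_n * 'M[R]_(n, p))) x v :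
  exp_det_form (d_terms (d_terms s)) x v = 0.
Proof.
rewrite /exp_det_form !big_map; apply: big1 => t _ /=.
rewrite -det_tr (determinant_alternate (i1 := 0) (i2 := 1)) ?mulr0 // => k.
rewrite !mxE; apply: eq_bigr => a _; congr (_ * _).
have -> : 1%R = lift ord0 ord0 :> 'I_p.+2 by exact/val_inj.
by rewrite row_mx_col0 row_mx_lift0 row_mx_col0.
Qed.

End ExpDetForms.

(** * Quotients of R^n by discrete affine groups *)

Lemma jacobian_near_affine (R : realType) (n : nat) (f : 'rV[R]_n -> 'rV[R]_n)
    (A : 'M[R]_n) (b x : 'rV[R]_n) :
  {near x, f =1 (fun y => y *m A + b)} -> jacobian f x = A.
Proof.
move=> fE; have [df _] := near_eq_diff (differentiable_affine A b x) fE.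
apply/row_matrixP => k; rewrite !rowE -(deriveEjacobian _ df).
by rewrite (near_eq_derive _ fE) derive_affine.
Qed.

Section RationalBalls.
Variables (R : realType) (n : nat).

Lemma rV_ballP (x y : 'rV[R]_n) (e : R) :
  ball x e y <-> 0 < e /\ forall i, `|x 0 i - y 0 i| < e.
Proof.
split=> [[e0 xy]|[e0 xy]]; split=> // i; first exact: xy.
by move=> j; rewrite ord1; exact: xy.
Qed.

Lemma open_rV_ball (x : 'rV[R]_n) (e : R) : open (ball x e).
Proof.
have [e0|e0] := ltP 0 e; first exact: ball_open.
suff -> : ball x e = set0 by exact: open0.
by apply/seteqP; split=> // y [/lt_le_trans/(_ e0)]; rewrite ltxx.
Qed.

Lemma rat_rV_ball (x : 'rV[R]_n) (e : R) : 0 < e ->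
  exists q : 'rV[rat]_n, ball (map_mx ratr q : 'rV[R]_n) e x.
Proof.
move=> e0.
have /choice[q qP] i : exists q : rat, x 0 i < ratr q < x 0 i + e.
  have [|q] := @rat_in_itvoo R (x 0 i) (x 0 i + e); first by rewrite ltrDl.
  by rewrite in_itv; exists q.
exists (\row_i q i); apply/rV_ballP; split=> // i.
rewrite !mxE; have := qP i; rewrite ltr_norml; lra.
Qed.

End RationalBalls.

Section AffineQuotient.
Variables (R : realType) (n : nat).

Local Notation X := 'rV[R]_n.

(* A set of affine maps x |-> x *m A b + b, indexed by their translation parts
   b, which forms a group acting freely, properly discontinuously and
   cocompactly; properness and freeness are both contained in
   [affine_discrete]. *)
Record affine_group := AffineGroup {
  affine_linear : X -> 'M[R]_n;
  affine_mem : set X;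
  affine_act := fun b x : X => x *m affine_linear b + b;
  affine_one : affine_mem 0 /\ forall x, affine_act 0 x = x;
  affine_inv : forall b, affine_mem b ->
    exists2 c, affine_mem c & forall x, affine_act c (affine_act b x) = x;
  affine_comp : forall b c, affine_mem b -> affine_mem c ->
    exists2 d, affine_mem d &
      forall x, affine_act d x = affine_act c (affine_act b x);
  affine_discrete : forall x y, exists2 e, 0 < e &
    forall b c z t, affine_mem b -> affine_mem c -> ball x e z -> ball x e t ->
      ball y e (affine_act b z) -> ball y e (affine_act c t) -> b = c;
  affine_cocompact : exists2 K, compact K &
    forall x, exists2 b, affine_mem b & K (affine_act b x)
}.

Variable G : affine_group.
Local Notation act := (@affine_act G).
Local Notation mem := (@affine_mem G).

Lemma continuous_act b : continuous (act b).
Proof. by move=> x; exact/differentiable_continuous/differentiable_affine. Qed.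

Definition orbit_rel : rel X := fun x y => `[< exists2 b, mem b & y = act b x >].

Lemma orbit_rel_refl : reflexive orbit_rel.
Proof. by move=> x; apply/asboolP; have [G1 act1] := affine_one G; exists 0. Qed.

Lemma orbit_rel_sym : symmetric orbit_rel.
Proof.
suff S x y : orbit_rel x y -> orbit_rel y x by move=> x y; apply/idP/idP => /S.
move=> /asboolP[b Gb ->]; apply/asboolP; have [c Gc bc] := affine_inv Gb.
by exists c.
Qed.

Lemma orbit_rel_trans : transitive orbit_rel.
Proof.
move=> y x z /asboolP[b Gb ->] /asboolP[c Gc ->]; apply/asboolP.
by have [d Gd dE] := affine_comp Gb Gc; exists d.
Qed.

Canonical orbit_equiv :=
  EquivRel orbit_rel orbit_rel_refl orbit_rel_sym orbit_rel_trans.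

Definition orbit_space : topologicalType :=
  quotient_topology {eq_quot orbit_equiv}%qT.

Definition orbit_proj (x : X) : orbit_space := (\pi_({eq_quot orbit_equiv}) x)%qT.

Lemma orbit_projP x y :
  orbit_proj x = orbit_proj y <-> exists2 b, mem b & y = act b x.
Proof.
split=> [xy|xy].
  by apply/asboolP; apply/(@eqmodP X orbit_equiv).
by apply/(@eqmodP X orbit_equiv)/asboolP.
Qed.

Lemma orbit_proj_act b x : mem b -> orbit_proj (act b x) = orbit_proj x.
Proof. by move=> Gb; apply/esym/orbit_projP; exists b. Qed.

Lemma orbit_proj_surj m : exists x, orbit_proj x = m.
Proof. by exists (generic_quotient.repr (m : {eq_quot orbit_equiv}%qT)); exact: reprK. Qed.

Lemma orbit_proj_continuous : continuous orbit_proj.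
Proof. exact: pi_continuous. Qed.

(** The saturation of [U] is the union of its preimages under the group elements, which are open. *)
Lemma orbit_proj_open U : open U -> open (orbit_proj @` U).
Proof.
move=> oU.
have -> : open (orbit_proj @` U) = open (orbit_proj @^-1` (orbit_proj @` U)) by [].
have -> : orbit_proj @^-1` (orbit_proj @` U) =
    \bigcup_(b in mem) (act b @^-1` U).
  apply/seteqP; split=> x /=.
    by move=> [y Uy /esym/orbit_projP[b Gb yE]]; exists b => //=; rewrite -yE.
  by move=> [b Gb Ux]; exists (act b x) => //; exact: orbit_proj_act.
apply: bigcup_open => b _; apply: open_comp => // x _; exact: continuous_act.
Qed.

Lemma nbhs_orbit_proj x U : nbhs x U -> nbhs (orbit_proj x) (orbit_proj @` U).
Proof.
move=> xU; have sub : orbit_proj @` U° `<=` orbit_proj @` U.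
  by move=> _ [y /interior_subset Uy <-]; exists y.
apply: (filterS sub); apply: open_nbhs_nbhs; split; last by exists x.
exact/orbit_proj_open/open_interior.
Qed.

(** If the orbits of x and y cannot be separated, arbitrarily small neighborhoods of x and y are
    linked by group elements. Inside the balls of [affine_discrete] the linking element is always
    the same b, and continuity gives y = act b x. *)
Lemma orbit_space_hausdorff : hausdorff_space orbit_space.
Proof.
move=> p q; have [x <-] := orbit_proj_surj p; have [y <-] := orbit_proj_surj q.
move=> cl.
have meet U V : nbhs x U -> nbhs y V ->
    exists b z, [/\ mem b, U z & V (act b z)].
  move=> xU yV; have := cl _ _ (nbhs_orbit_proj xU) (nbhs_orbit_proj yV).
  move=> [_ [[z Uz <-] [t Vt /esym/orbit_projP[b Gb tE]]]].
  by exists b, z; rewrite -tE.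
have [e e0 uniq_e] := affine_discrete G x y.
have [b [z [Gb xz yz]]] := meet _ _ (nbhsx_ballx x e e0) (nbhsx_ballx y e e0).
apply/orbit_projP; exists b => //; apply/esym/norm_hausdorff => U V bU yV.
have xU : nbhs x (ball x e `&` act b @^-1` U).
  by apply: filterI; [exact: nbhsx_ballx|exact: continuous_act].
have yV' : nbhs y (ball y e `&` V) by apply: filterI => //; exact: nbhsx_ballx.
have [c [t [Gc [xt Ut] [yt Vt]]]] := meet _ _ xU yV'.
by exists (act b t); split => //; rewrite (uniq_e b c z t).
Qed.

Lemma orbit_space_compact : compact [set: orbit_space].
Proof.
have [K cK KG] := affine_cocompact G.
have -> : [set: orbit_space] = orbit_proj @` K.
  apply/seteqP; split=> // p _; have [x <-] := orbit_proj_surj p.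
  by have [b Gb Kx] := KG x; exists (act b x) => //; exact: orbit_proj_act.
apply: continuous_compact => //; apply: continuous_subspaceT.
exact: orbit_proj_continuous.
Qed.

Lemma orbit_space_second_countable : @second_countable orbit_space.
Proof.
pose B (t : 'rV[rat]_n * nat) : set orbit_space :=
  orbit_proj @` ball (map_mx ratr t.1 : X) t.2.+1%:R^-1.
exists (range B).
  by apply: sub_countable (card_image_le _ _) _; exact: countableP.
split=> [_ [t _ <-]|p N /= pN].
  exact/orbit_proj_open/open_rV_ball.
have [x xp] := orbit_proj_surj p.
have : nbhs x (orbit_proj @^-1` N).
  by apply: orbit_proj_continuous; rewrite xp.
move=> /nbhs_ballP[e /= e0 xN].
(* With radius below e/2, a rational ball that contains [x] lies within distance e of [x]. *)
have [k] := ltr_add_invr (divr_gt0 e0 (ltr0n R 2)); rewrite add0r => ke.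
have k0 : 0 < k.+1%:R^-1 :> R by rewrite invr_gt0.
have [q qx] := rat_rV_ball x k0.
exists (B (q, k)); first split.
- by exists (q, k).
- by rewrite -xp; exists x.
- move=> _ [z qz <-]; apply: xN; apply: ball_splitr (le_ball (ltW ke) qx) _.
  exact: le_ball (ltW ke) _ qz.
Qed.

(** The case x = y of [affine_discrete]. Taking c = 0, the identity, shows that no other element
    maps a point of the ball into the ball, hence that the projection is injective there. *)
Definition uniform_ball (pe : X * R) := 0 < pe.2 /\
  forall b c z t, mem b -> mem c -> ball pe.1 pe.2 z -> ball pe.1 pe.2 t ->
    ball pe.1 pe.2 (act b z) -> ball pe.1 pe.2 (act c t) -> b = c.

Definition chart_center := {pe : X * R | uniform_ball pe}.

Section Chart.
Variable i : chart_center.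
Let U : set X := ball (sval i).1 (sval i).2.

Lemma orbit_proj_inj x y : U x -> U y -> orbit_proj x = orbit_proj y -> x = y.
Proof.
move=> Ux Uy /orbit_projP[b Gb yE]; have [_ inj] := svalP i.
have [G0 act0] := affine_one G.
by rewrite yE (inj b 0 x x) // ?act0 // -yE.
Qed.

Definition orbit_section (p : orbit_space) : X :=
  xget 0 [set x | U x /\ orbit_proj x = p].

Lemma orbit_sectionP p : (orbit_proj @` U) p ->
  U (orbit_section p) /\ orbit_proj (orbit_section p) = p.
Proof.
move=> [x Ux xp]; rewrite /orbit_section; case: xgetP => [y -> //|/(_ x)].
by case; split.
Qed.

Lemma orbit_sectionK x : U x -> orbit_section (orbit_proj x) = x.
Proof.
move=> Ux; have [|Uy] := @orbit_sectionP (orbit_proj x); first by exists x.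
exact: orbit_proj_inj.
Qed.

(** The section inverts the projection, which is open and injective on [U]. *)
Lemma orbit_section_continuous :
  {within orbit_proj @` U, continuous orbit_section}.
Proof.
rewrite continuous_open_subspace; last exact/orbit_proj_open/open_rV_ball.
move=> _ /set_mem[x Ux <-] N; rewrite orbit_sectionK // => xN.
have /nbhs_orbit_proj : nbhs x (U `&` N).
  by apply: filterI => //; apply: open_nbhs_nbhs; split => //; exact: open_rV_ball.
by apply: filterS => _ [y [Uy Ny] <-] /=; rewrite orbit_sectionK.
Qed.

(** Every chart has the same inverse map, the projection; this is why a local expression can be
    independent of the chart. *)
Definition orbit_chart : chart R n orbit_space.
Proof.
refine (@Chart R n orbit_space (orbit_proj @` U) U orbit_section orbit_proj
  _ _ _ _ _ _ _ _).
- exact/orbit_proj_open/open_rV_ball.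
- exact: open_rV_ball.
- by move=> p /orbit_sectionP[].
- by move=> x Ux; exists x.
- by move=> p /orbit_sectionP[].
- exact: orbit_sectionK.
- exact: orbit_section_continuous.
- by apply: continuous_subspaceT; exact: orbit_proj_continuous.
Defined.

End Chart.

Lemma orbit_chart_cover p : exists i, chart_dom (orbit_chart i) p.
Proof.
have [x <-] := orbit_proj_surj p; have [e e0 eP] := affine_discrete G x x.
by exists (exist _ (x, e) (conj e0 eP)); exists x => //; exact: ballxx.
Qed.

(** An overlap may be disconnected, so b depends on x. The same b works near x because [act b] still
    sends nearby points into the open ball of chart j. *)
Lemma orbit_transition i j x : overlap (orbit_chart i) (orbit_chart j) x ->
  exists2 b, mem b &
    {near x, transition (orbit_chart i) (orbit_chart j) =1 act b}.
Proof.
move=> [/= Ux jx]; have [Uy yE] := @orbit_sectionP j (orbit_proj x) jx.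
have /esym/orbit_projP[b Gb bE] := yE; exists b => //.
have xU : nbhs x (act b @^-1` ball (sval j).1 (sval j).2).
  apply: continuous_act; apply: open_nbhs_nbhs.
  by split; [exact: open_rV_ball|rewrite -bE].
apply: filterS xU => y /= Uby.
by rewrite /transition /= -(orbit_proj_act y Gb) orbit_sectionK.
Qed.

Definition orbit_manifold : smoothManifold R n.
Proof.
refine (@SmoothManifold R n orbit_space orbit_space_hausdorff
  orbit_space_second_countable chart_center orbit_chart orbit_chart_cover _).
move=> i j; apply: smooth_on_local => x /orbit_transition[b Gb bE].
by exists (act b); split => //; exact: smooth_affine.
Defined.

Lemma orbit_overlap (i j : atlas_index orbit_manifold) x :
  overlap (atlas i) (atlas j) x -> exists b, [/\ mem b,
    transition (atlas i) (atlas j) x = act b x &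
    jacobian (transition (atlas i) (atlas j)) x = affine_linear G b].
Proof.
move=> /orbit_transition[b Gb bE]; exists b; split => //.
  exact: nbhs_singleton bE.
exact: jacobian_near_affine bE.
Qed.

(** Transition maps are locally group elements, so compatibility of the local expressions reduces to
    invariance under the group. *)
Lemma diff_form_invariant k (a : X -> kform R n R k) :
  (forall x, multilinear (a x)) -> (forall x, alternate (a x)) ->
  (forall v, exp_sum (fun x => a x v)) ->
  (forall b x v, mem b -> a (act b x) (v *m affine_linear G b) = a x v) ->
  @diff_form R n orbit_manifold k (fun _ => a).
Proof.
move=> am aa ae ai; split=> // [i v|i j x v /orbit_overlap[b [Gb -> ->]]].
  exact: exp_sum_smooth.
by rewrite ai.
Qed.

End AffineQuotient.

(** * The lattice of Sol x Sol *)

Section SolLattice.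
Variable R : realType.

Definition sqrt3 : R := Num.sqrt 3.
Definition log_unit : R := ln (2 + sqrt3).

Lemma sqrt3_sqr : sqrt3 * sqrt3 = 3.
Proof. by rewrite -expr2 sqr_sqrtr. Qed.

Lemma sqrt3_ge1 : 1 <= sqrt3.
Proof. by rewrite -sqrtr1 ler_sqrt // ler1n. Qed.

Lemma sqrt3_le2 : sqrt3 <= 2.
Proof. have := sqrt3_sqr; have := sqrt3_ge1; nra. Qed.

Lemma log_unit_gt0 : 0 < log_unit.
Proof. by apply: ln_gt0; have := sqrt3_ge1; lra. Qed.

Lemma expR_log_unit : expR log_unit = 2 + sqrt3.
Proof. by rewrite lnK // posrE; have := sqrt3_ge1; lra. Qed.

Lemma expRN_log_unit : expR (- log_unit) = 2 - sqrt3.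
Proof.
have s0 : 2 + sqrt3 != 0 by rewrite gt_eqF //; have := sqrt3_ge1; lra.
apply: (mulfI s0); rewrite expRN expR_log_unit mulfV //.
have -> : (2 + sqrt3) * (2 - sqrt3) = 4 - sqrt3 * sqrt3 by ring.
by rewrite sqrt3_sqr; ring.
Qed.

(* The ring Z[sqrt 3], embedded in R^2 by its two real embeddings; the unit
   2 + sqrt 3, of norm 1, acts on it by a hyperbolic diagonal matrix. *)
Definition int_sqrt3 (x y : R) := exists a b : int,
  x = a%:~R + b%:~R * sqrt3 /\ y = a%:~R - b%:~R * sqrt3.

Lemma int_sqrt3B x y x' y' :
  int_sqrt3 x y -> int_sqrt3 x' y' -> int_sqrt3 (x - x') (y - y').
Proof.
move=> [a [b [-> ->]]] [a' [b' [-> ->]]]; exists (a - a'), (b - b').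
by rewrite !rmorphB /=; split; ring.
Qed.

Lemma int_sqrt3_unit x y : int_sqrt3 x y ->
  int_sqrt3 (expR (- log_unit) * x) (expR log_unit * y).
Proof.
move=> [a [b [-> ->]]]; rewrite expRN_log_unit expR_log_unit.
(* The coordinates of (2 - sqrt 3)(a + b sqrt 3) in the basis 1, sqrt 3. *)
exists (2 * a - 3 * b), (2 * b - a).
rewrite !rmorphB !rmorphM /= -[3%:~R]/(3 : R) -sqrt3_sqr.
by split; ring.
Qed.

Lemma int_sqrt3C x y : int_sqrt3 x y -> int_sqrt3 y x.
Proof.
move=> [a [b [-> ->]]]; exists a, (- b).
by rewrite rmorphN /= mulNr opprK.
Qed.

Lemma int_sqrt3_scale (k : int) x y : int_sqrt3 x y ->
  int_sqrt3 (expR (- (k%:~R * log_unit)) * x) (expR (k%:~R * log_unit) * y).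
Proof.
have pos (n : nat) x' y' : int_sqrt3 x' y' ->
    int_sqrt3 (expR (- (n%:R * log_unit)) * x') (expR (n%:R * log_unit) * y').
  move=> Lxy; elim: n => [|n IH]; first by rewrite mul0r oppr0 expR0 !mul1r.
  rewrite -natr1 mulrDl mul1r opprD [- _ + _]addrC [n%:R * _ + _]addrC !expRD.
  by rewrite -!mulrA; exact: int_sqrt3_unit.
case: k => n Lxy; first exact: pos.
(* Swapping the two embeddings exchanges the unit and its inverse, which reduces negative powers to
   positive ones. *)
rewrite NegzE rmorphN /= mulNr opprK.
by apply: int_sqrt3C; apply: pos; exact: int_sqrt3C.
Qed.

(** From x + y = 2a one gets |a| < 1, so a = 0; then |b| sqrt 3 < 1 forces b = 0. *)
Lemma int_sqrt3_discrete x y :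
  int_sqrt3 x y -> `|x| < 1 -> `|y| < 1 -> x = 0 /\ y = 0.
Proof.
have small (k : int) : `|k%:~R : R| < 1 -> k = 0.
  by rewrite -intr_norm -[1]/(1%:~R) ltr_int; case: k => [[|n]|n].
move=> [a [b [-> ->]]] /[!ltr_norml] x1 y1.
have a0 : a = 0 by apply: small; rewrite ltr_norml; lra.
move: x1 y1; rewrite a0 mulr0z add0r sub0r => x1 y1.
have -> : b = 0.
  by apply: small; rewrite ltr_norml; have := sqrt3_ge1; nra.
by rewrite mulr0z mul0r oppr0.
Qed.

Lemma floor_frac (x : R) : exists k : int, 0 <= x - k%:~R <= 1.
Proof.
exists (Num.floor x); have := floor_le x; have := floorD1_gt x.
by rewrite rmorphD /=; lra.
Qed.

(** Rounding down the coordinates of (x, y) in the basis (1, 1), (sqrt 3, - sqrt 3) leaves a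
    remainder of size at most 1 + sqrt 3 <= 3. *)
Lemma int_sqrt3_cobounded x y :
  exists u v, [/\ int_sqrt3 u v, `|x + u| <= 3 & `|y + v| <= 3].
Proof.
have [a aP] := floor_frac ((x + y) / 2).
have s0 : sqrt3 != 0 by have := sqrt3_ge1; case: eqP => // ->; lra.
have [b bP] := floor_frac ((x - y) / (2 * sqrt3)).
have xE : x = (x + y) / 2 + (x - y) / (2 * sqrt3) * sqrt3 by field.
have yE : y = (x + y) / 2 - (x - y) / (2 * sqrt3) * sqrt3 by field.
exists (- a%:~R - b%:~R * sqrt3), (- a%:~R + b%:~R * sqrt3); split.
- by exists (- a), (- b); rewrite !rmorphN /=; split; ring.
- rewrite [X in X + _]xE; move: aP bP; set A := (x + y) / 2; set B := (x - y) / _.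
  move=> aP bP; have := sqrt3_ge1; have := sqrt3_le2; rewrite ler_norml; nra.
- rewrite [X in X + _]yE; move: aP bP; set A := (x + y) / 2; set B := (x - y) / _.
  move=> aP bP; have := sqrt3_ge1; have := sqrt3_le2; rewrite ler_norml; nra.
Qed.

End SolLattice.

(** * The affine action of the lattice on R^6 *)

Section SolGroup.
Variable R : realType.

Local Notation X := 'rV[R]_(3 + 3).
Local Notation lc := (log_unit R).
Implicit Types (x y z t b c : X) (j : 'I_3).

(* Coordinates on R^6 are grouped in pairs (x_j, y_j) = (x 0 (lshift 3 j),
   x 0 (rshift 3 j)); the pair j = 0 is the base direction (t, s) and the two
   other pairs are scaled by e^(-t), e^t and e^(-s), e^s respectively. *)
Definition weight j : 'cV[R]_(3 + 3) :=
  if j == 0 then 0 else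
  if j == 1 then delta_mx (lshift 3 0) 0 else delta_mx (rshift 3 0) 0.

Definition wt j x : R := (x *m weight j) 0 0.

Lemma wtE j x : wt j x =
  if j == 0 then 0 else if j == 1 then x 0 (lshift 3 0) else x 0 (rshift 3 0).
Proof.
rewrite /wt /weight; case: ifP => _; first by rewrite mulmx0 mxE.
by case: ifP => _; rewrite -colE mxE.
Qed.

Lemma wtN j x : wt j (- x) = - wt j x.
Proof. by rewrite /wt mulNmx mxE. Qed.

Definition sol_exponents b : X :=
  row_mx (\row_j expR (- wt j b)) (\row_j expR (wt j b)).

Definition sol_linear b : 'M[R]_(3 + 3) := diag_mx (sol_exponents b).

Definition sol_act b x : X := x *m sol_linear b + b.

Lemma sol_actl b x j : sol_act b x 0 (lshift 3 j) =
  x 0 (lshift 3 j) * expR (- wt j b) + b 0 (lshift 3 j).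
Proof.
by rewrite /sol_act [LHS]mxE mul_mx_diag [X in X + _ = _]mxE row_mxEl [X in _ * X]mxE.
Qed.

Lemma sol_actr b x j : sol_act b x 0 (rshift 3 j) =
  x 0 (rshift 3 j) * expR (wt j b) + b 0 (rshift 3 j).
Proof.
by rewrite /sol_act [LHS]mxE mul_mx_diag [X in X + _ = _]mxE row_mxEr [X in _ * X]mxE.
Qed.

Lemma pair_coordP x y :
  (forall j, x 0 (lshift 3 j) = y 0 (lshift 3 j)) ->
  (forall j, x 0 (rshift 3 j) = y 0 (rshift 3 j)) -> x = y.
Proof. by move=> l r; apply/rowP => k; case: (split_ordP k) => j ->. Qed.

(** Weights are read off the base pair, which has weight 0 and is therefore only translated. *)
Lemma wt_act j b x : wt j (sol_act b x) = wt j x + wt j b.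
Proof.
have w0 c : wt 0 c = 0 by rewrite wtE.
rewrite !wtE; case: ifP => _; first by rewrite addr0.
by case: ifP => _; rewrite (sol_actl, sol_actr) w0 ?oppr0 expR0 mulr1.
Qed.

(** Base translations are multiples of [lc] so that the fibers are scaled by powers of the unit,
    which preserve the lattice Z[sqrt 3]. *)
Definition pair_lattice j (u v : R) :=
  if j == 0 then (exists k : int, u = k%:~R * lc) /\ (exists l : int, v = l%:~R * lc)
  else int_sqrt3 u v.

Definition sol_lattice b :=
  forall j, pair_lattice j (b 0 (lshift 3 j)) (b 0 (rshift 3 j)).

Lemma pair_latticeB j u v u' v' :
  pair_lattice j u v -> pair_lattice j u' v' -> pair_lattice j (u - u') (v - v').
Proof.
rewrite /pair_lattice; case: ifP => _; last exact: int_sqrt3B.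
move=> [[k ->] [l ->]] [[k' ->] [l' ->]].
by split; [exists (k - k')|exists (l - l')]; rewrite rmorphB mulrBl.
Qed.

Lemma pair_lattice0 j : pair_lattice j 0 0.
Proof.
rewrite /pair_lattice; case: ifP => _.
  by split; exists 0; rewrite mul0r.
by exists 0, 0; rewrite mul0r addr0 subr0.
Qed.

Lemma pair_latticeN j u v : pair_lattice j u v -> pair_lattice j (- u) (- v).
Proof. by move/(pair_latticeB (pair_lattice0 j)); rewrite !sub0r. Qed.

Lemma pair_latticeD j u v u' v' :
  pair_lattice j u v -> pair_lattice j u' v' -> pair_lattice j (u + u') (v + v').
Proof. by move=> uv /pair_latticeN/(pair_latticeB uv); rewrite !opprK. Qed.

Lemma pair_lattice_scale j b u v : sol_lattice b -> pair_lattice j u v ->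
  pair_lattice j (u * expR (- wt j b)) (v * expR (wt j b)).
Proof.
move=> /(_ 0); rewrite /pair_lattice wtE /= => -[[k bk] [l bl]].
case: ifP => _; first by rewrite oppr0 expR0 !mulr1.
by case: ifP => _ uv; rewrite ?bk ?bl (mulrC u) (mulrC v); exact: int_sqrt3_scale.
Qed.

Lemma pair_lattice_discrete j u v : pair_lattice j u v ->
  `|u| < Num.min 1 lc -> `|v| < Num.min 1 lc -> u = 0 /\ v = 0.
Proof.
rewrite /pair_lattice !lt_min; case: ifP => _; last first.
  by move=> uv /andP[u1 _] /andP[v1 _]; exact: int_sqrt3_discrete.
have lc0 := log_unit_gt0 R.
have small (k : int) : `|k%:~R * lc| < lc -> k%:~R * lc = 0.
  rewrite normrM (gtr0_norm lc0) gtr_pMl // -intr_norm -[1]/(1%:~R) ltr_int.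
  by case: k => [[|n]|n] // _; rewrite mul0r.
by move=> [[k ->] [l ->]] /andP[_ /small ->] /andP[_ /small ->].
Qed.

Lemma pair_lattice_cobounded j (u v : R) : exists a b : R,
  [/\ pair_lattice j a b, `|u + a| <= 3 + lc & `|v + b| <= 3 + lc].
Proof.
have lc0 := log_unit_gt0 R; rewrite /pair_lattice; have [_|_] := eqVneq j 0; last first.
  have [a [b [ab ua vb]]] := int_sqrt3_cobounded u v; exists a, b.
  by split => //; [apply: le_trans ua _|apply: le_trans vb _]; rewrite lerDl ltW.
have mult w : exists2 k : int, True & `|w + k%:~R * lc| <= 3 + lc.
  have [k kP] := floor_frac (w / lc); exists (- k) => //.
  have -> : w + (- k)%:~R * lc = (w / lc - k%:~R) * lc.
    by rewrite rmorphN /=; field; rewrite gt_eqF.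
  by move: kP; set q := _ - _ => kP; rewrite ler_norml; nra.
have [k _ kP] := mult u; have [l _ lP] := mult v.
by exists (k%:~R * lc), (l%:~R * lc); split => //; split; [exists k|exists l].
Qed.

Lemma sol_lattice_one : sol_lattice 0 /\ forall x, sol_act 0 x = x.
Proof.
split=> [j|x]; first by rewrite !mxE; exact: pair_lattice0.
have w0 j : wt j 0 = 0 by rewrite /wt mul0mx mxE.
by apply: pair_coordP => j; rewrite (sol_actl, sol_actr) w0 ?oppr0 expR0 mxE mulr1 addr0.
Qed.

Lemma sol_lattice_act b c : sol_lattice b -> sol_lattice c -> sol_lattice (sol_act c b).
Proof.
move=> Lb Lc j; rewrite sol_actl sol_actr; apply: pair_latticeD => //.
exact: pair_lattice_scale.
Qed.

(** An element is indexed by its value at 0, and the composite sends 0 to [sol_act c b]. *)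
Lemma sol_act_act b c x : sol_act (sol_act c b) x = sol_act c (sol_act b x).
Proof.
apply: pair_coordP => j; rewrite !(sol_actl, sol_actr) wt_act ?opprD expRD; ring.
Qed.

Definition sol_inv b : X :=
  row_mx (\row_j - (b 0 (lshift 3 j) * expR (wt j b)))
         (\row_j - (b 0 (rshift 3 j) * expR (- wt j b))).

Lemma wt_inv j b : wt j (sol_inv b) = - wt j b.
Proof.
have w0 c : wt 0 c = 0 by rewrite wtE.
rewrite !wtE; case: ifP => _; first by rewrite oppr0.
by case: ifP => _; rewrite (row_mxEl, row_mxEr) mxE w0 ?oppr0 expR0 mulr1.
Qed.

Lemma sol_lattice_inv b : sol_lattice b ->
  exists2 c, sol_lattice c & forall x, sol_act c (sol_act b x) = x.
Proof.
move=> Lb; exists (sol_inv b).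
  have LN : sol_lattice (- b) by move=> j; rewrite !mxE; exact: pair_latticeN.
  move=> j; rewrite row_mxEl row_mxEr !mxE -!mulNr.
  by have := pair_lattice_scale LN (LN j); rewrite wtN opprK !mxE.
have exprK w : expR w * expR (- w) = 1 by rewrite -expRD subrr expR0.
move=> x; apply: pair_coordP => j; rewrite !(sol_actl, sol_actr) wt_inv.
  by rewrite row_mxEl mxE opprK mulrDl -mulrA [expR (- _) * _]mulrC exprK mulr1 addrK.
by rewrite row_mxEr mxE mulrDl -mulrA exprK mulr1 addrK.
Qed.

(** The scalings of the fibers depend on the base parts of b and c, so equality is shown first on
    the base pair, where nothing is scaled. After that b and c scale each fiber by the same bounded
    factor. *)
Lemma sol_lattice_discrete x y : exists2 e, 0 < e &
  forall b c z t, sol_lattice b -> sol_lattice c -> ball x e z -> ball x e t ->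
    ball y e (sol_act b z) -> ball y e (sol_act c t) -> b = c.
Proof.
have lc0 := log_unit_gt0 R.
(* The base part of an admissible b differs from that of y - x by less than 2e <= 1, so [B] bounds
   its weights. *)
pose B : R := `|wt 1 (y - x)| + `|wt 2 (y - x)| + 1.
pose d : R := Num.min 1 lc.
have d0 : 0 < d by rewrite lt_min ltr01.
have d1 : d <= 1 by rewrite ge_min lexx.
(* The difference of two translation parts is at most 2e from the targets plus 2e expR B from the
   scaled sources, that is, d/2 in total. *)
pose e : R := d / (4 * (1 + expR B)).
have E0 := expR_gt0 B.
have e0 : 0 < e by rewrite divr_gt0 // mulr_gt0 // addr_gt0.
have eE : e * (4 * (1 + expR B)) = d by rewrite mulfVK // gt_eqF // mulr_gt0 // addr_gt0.
exists e => // b c z t Lb Lc /rV_ballP[_ xz] /rV_ballP[_ xt] /rV_ballP[_ yz] /rV_ballP[_ yt].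
(* Once b and c have the same weight w on the j-th pair, both coordinates of
   b - c in this pair are smaller than d. *)
have step j : wt j b = wt j c -> `|wt j b| <= B ->
    b 0 (lshift 3 j) = c 0 (lshift 3 j) /\ b 0 (rshift 3 j) = c 0 (rshift 3 j).
  move=> bc bB.
  have small (z' t' b' c' x' y' w : R) : `|w| <= B ->
      `|x' - z'| < e -> `|x' - t'| < e ->
      `|y' - (z' * expR w + b')| < e -> `|y' - (t' * expR w + c')| < e ->
      `|b' - c'| < d.
    move=> wB; have : expR w <= expR B.
      by rewrite ler_expR (le_trans _ wB) // ler_norm.
    have := expR_gt0 w; rewrite !ltr_norml -eE; set E := expR w; set F := expR B.
    move=> Ew EF /andP[? ?] /andP[? ?] /andP[? ?] /andP[? ?].
    have : (- (2 * e)) * E <= (z' - t') * E <= (2 * e) * E.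
      by rewrite !ler_pM2r //; lra.
    have : e * E <= e * F by rewrite ler_pM2l.
    lra.
  have [] := @pair_lattice_discrete j (b 0 (lshift 3 j) - c 0 (lshift 3 j))
      (b 0 (rshift 3 j) - c 0 (rshift 3 j)).
  - exact: pair_latticeB.
  - have := yz (lshift 3 j); have := yt (lshift 3 j); rewrite !sol_actl -bc => yt' yz'.
    by apply: small (xz _) (xt _) yz' yt'; rewrite normrN.
  - have := yz (rshift 3 j); have := yt (rshift 3 j); rewrite !sol_actr -bc => yt' yz'.
    exact: small (xz _) (xt _) yz' yt'.
  - by move=> /subr0_eq -> /subr0_eq ->.
have B0 : 0 <= B by rewrite !addr_ge0.
have [l0 r0] : b 0 (lshift 3 0) = c 0 (lshift 3 0) /\
    b 0 (rshift 3 0) = c 0 (rshift 3 0).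
  by apply: step; rewrite !wtE // normr0.
have bc j : wt j b = wt j c by rewrite !wtE l0 r0.
have bB j : `|wt j b| <= B.
  have e2 : e <= 1 / 2.
    by rewrite -(ler_pM2r (_ : 0 < 4 * (1 + expR B))) ?eE ?mulr_gt0 ?addr_gt0 //; nra.
  have near (u v p q : R) : `|u - p| < e -> `|v - (p + q)| < e ->
      `|q| <= `|v - u| + 1.
    move=> up vq; have -> : q = (v - u) - ((v - (p + q)) - (u - p)) by ring.
    apply: le_trans (ler_normB _ _) _; rewrite lerD2l.
    by apply: le_trans (ler_normB _ _) _; lra.
  have := yz (lshift 3 0); have := yz (rshift 3 0).
  rewrite sol_actl sol_actr [wt 0 b]wtE /= oppr0 expR0 !mulr1.
  move=> /(near _ _ _ _ (xz _)) rb /(near _ _ _ _ (xz _)) lb.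
  rewrite wtE /B !wtE /= !mxE; case: ifP => _.
    by rewrite normr0 !addr_ge0.
  by case: ifP => _; [apply: le_trans lb _|apply: le_trans rb _]; rewrite lerD2r ?lerDl ?lerDr.
have bcj j := step j (bc j) (bB j).
by apply: pair_coordP => j; have [] := bcj j.
Qed.

(** The base translation is chosen first; it fixes the scaling of the fibers, and the scaled fiber
    coordinates are then moved into the box. *)
Lemma sol_lattice_cocompact : exists2 K, compact K &
  forall x, exists2 b, sol_lattice b & K (sol_act b x).
Proof.
exists [set x : X | forall i, x 0 i \in `[- (3 + lc), 3 + lc]].
  by apply: (@rV_compact _ _ (fun=> [set` _])) => i; exact: segment_compact.
move=> x.
have [s [t st]] := pair_lattice_cobounded 0 (x 0 (lshift 3 0)) (x 0 (rshift 3 0)).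
pose w j : R := if j == 0 then 0 else if j == 1 then s else t.
(* The last clause ensures that the [b] assembled from these choices has the weights [w] used to
   make them. *)
have /choice[f fP] j : exists uv : R * R, [/\ pair_lattice j uv.1 uv.2,
    `|x 0 (lshift 3 j) * expR (- w j) + uv.1| <= 3 + lc,
    `|x 0 (rshift 3 j) * expR (w j) + uv.2| <= 3 + lc & j = 0 -> uv = (s, t)].
  have [->|j0] := eqVneq j 0.
    by exists (s, t); rewrite /w eqxx oppr0 expR0 !mulr1; case: st.
  have [u [v [uv u3 v3]]] := pair_lattice_cobounded j
    (x 0 (lshift 3 j) * expR (- w j)) (x 0 (rshift 3 j) * expR (w j)).
  by exists (u, v); split => // j0'; rewrite j0' eqxx in j0.
pose b : X := row_mx (\row_j (f j).1) (\row_j (f j).2).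
have bl j : b 0 (lshift 3 j) = (f j).1 by rewrite row_mxEl mxE.
have br j : b 0 (rshift 3 j) = (f j).2 by rewrite row_mxEr mxE.
have wb j : wt j b = w j.
  by rewrite wtE bl br; have [_ _ _ ->] := fP 0.
exists b => [j|i]; first by rewrite bl br; have [] := fP j.
rewrite in_itv /= -ler_norml; have [j ->|j ->] := split_ordP i.
  by rewrite sol_actl wb bl; have [] := fP j.
by rewrite sol_actr wb br; have [] := fP j.
Qed.

Definition sol_group : affine_group R (3 + 3) :=
  @AffineGroup R (3 + 3) sol_linear sol_lattice sol_lattice_one sol_lattice_inv
    (fun b c Lb Lc => ex_intro2 _ _ (sol_act c b) (sol_lattice_act Lb Lc)
       (sol_act_act b c))
    sol_lattice_discrete sol_lattice_cocompact.

End SolGroup.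

(** * The cube of the standard symplectic form *)

Section SmallDeterminants.
Variable K : comNzRingType.

(* Unlike [\det], Laplace expansion on functions of natural numbers can be
   evaluated by computation. *)
Fixpoint det_nat (n : nat) (F : nat -> nat -> int) : int :=
  if n is m.+1 then
    foldr (fun j acc => (if F 0%N j == 0 then 0 else
        (-1) ^+ j * F 0%N j * det_nat m (fun i k => F i.+1 (bump j k))) + acc)
      0 (iota 0 n)
  else 1.

Lemma det_natE n (F : nat -> nat -> int) :
  \det (\matrix_(i < n, j < n) (F i j)%:~R : 'M[K]_n) = (det_nat n F)%:~R.
Proof.
elim: n F => [|n IH] F; first by rewrite det_mx00.
have -> : det_nat n.+1 F = \sum_(j <- iota 0 n.+1)
    (-1) ^+ j * F 0%N j * det_nat n (fun i k => F i.+1 (bump j k)).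
  suff foldrE s : foldr (fun j acc => (if F 0%N j == 0 then 0 else
      (-1) ^+ j * F 0%N j * det_nat n (fun i k => F i.+1 (bump j k))) + acc) 0 s =
      \sum_(j <- s) (-1) ^+ j * F 0%N j * det_nat n (fun i k => F i.+1 (bump j k)).
    exact: foldrE (iota 0 n.+1).
  elim: s => [|j s IHs]; first by rewrite big_nil.
  by rewrite big_cons -IHs /=; case: eqP => // ->; rewrite mulr0 mul0r.
rewrite (expand_det_row _ ord0) -[X in iota 0 X](subn0 n.+1).
rewrite -/(index_iota 0 n.+1) (big_mkord xpredT) rmorph_sum.
apply: eq_bigr => j _; rewrite !rmorphM rmorphXn rmorphN1 /= -IH !mxE /cofactor.
rewrite add0n mulrCA mulrA; congr (_ * \det _).
by apply/matrixP => i k; rewrite !mxE.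
Qed.

Lemma det_mx22 (A : 'M[K]_2) : \det A = A 0 0 * A 1 1 - A 0 1 * A 1 0.
Proof.
rewrite (expand_det_row _ 0) !big_ord_recl big_ord0 addr0 /cofactor !det_mx11.
rewrite !mxE /=.
have -> : lift 0 0 = 1 :> 'I_2 by exact/val_inj.
have -> : lift 1 0 = 0 :> 'I_2 by exact/val_inj.
by ring.
Qed.

Lemma det_mx33 (A : 'M[K]_3) : \det A =
  A 0 0 * (A 1 1 * A 2 2 - A 1 2 * A 2 1)
  - A 0 1 * (A 1 0 * A 2 2 - A 1 2 * A 2 0)
  + A 0 2 * (A 1 0 * A 2 1 - A 1 1 * A 2 0).
Proof.
rewrite (expand_det_row _ 0) !big_ord_recl big_ord0 addr0 /cofactor !det_mx22.
rewrite !mxE /=.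
have l01 : lift 0 0 = 1 :> 'I_3 by exact/val_inj.
have l02 : lift 0 1 = 2 :> 'I_3 by exact/val_inj.
have l10 : lift 1 0 = 0 :> 'I_3 by exact/val_inj.
have l12 : lift 1 1 = 2 :> 'I_3 by exact/val_inj.
have l20 : lift 2 0 = 0 :> 'I_3 by exact/val_inj.
have l21 : lift 2 1 = 1 :> 'I_3 by exact/val_inj.
have l0 : lift ord0 ord0 = 1 :> 'I_3 by exact/val_inj.
have l00 : lift ord0 (lift ord0 ord0) = 2 :> 'I_3 by exact/val_inj.
rewrite ?(l00, l0, l01, l02, l10, l12, l20, l21) /=.
by ring.
Qed.

End SmallDeterminants.

Section WedgeBilinear.
Variables (R : realType) (n : nat) (K : fieldType).

Lemma wedge_sum p q I J (r : seq I) (s : seq J)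
    (a : I -> kform R n K p) (b : J -> kform R n K q) v :
  wedge (fun u => \sum_(i <- r) a i u) (fun u => \sum_(j <- s) b j u) v =
  \sum_(i <- r) \sum_(j <- s) wedge (a i) (b j) v.
Proof.
rewrite /wedge.
under [RHS]eq_bigr do rewrite -mulr_sumr.
rewrite -mulr_sumr; congr (_ * _).
under [RHS]eq_bigr do rewrite exchange_big.
rewrite exchange_big; apply: eq_bigr => t _ /=.
rewrite [X in X * _]mulr_sumr mulr_suml; apply: eq_bigr => i _.
by rewrite mulr_sumr.
Qed.

Lemma wedgeZ p q c d (a : kform R n K p) (b : kform R n K q) v :
  wedge (fun u => c * a u) (fun u => d * b u) v = c * d * wedge a b v.
Proof.
rewrite /wedge mulrCA; congr (_ * _); rewrite mulr_sumr.
by apply: eq_bigr => s _; rewrite [_ * (c * _)]mulrCA mulrACA.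
Qed.

End WedgeBilinear.

Section StandardSymplecticForm.
Variable R : realType.

Definition coord_pair n (k l : 'I_n) : 'M[R]_(n, 2) :=
  \matrix_(i, d) (i == if d == 0 then k else l)%:R.

Lemma mulmx_coord_pair m n (v : 'M[R]_(m, n)) k l i d :
  (v *m coord_pair k l) i d = v i (if d == 0 then k else l).
Proof.
set a := if _ then _ else _; rewrite mxE (bigD1 a) //= mxE eqxx mulr1.
by rewrite big1 ?addr0 // => b /negPf ba; rewrite mxE ba mulr0.
Qed.

Lemma det_coord_pair n (v : 'M[R]_(2, n)) k l :
  \det (v *m coord_pair k l) = v 0 k * v 1 l - v 0 l * v 1 k.
Proof. by rewrite det_mx22 !mulmx_coord_pair. Qed.

Definition std_pair (j : 'I_3) := coord_pair (lshift 3 j) (rshift 3 j).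

Definition std_symplectic : kform R (3 + 3) R 2 :=
  fun v => \sum_j \det (v *m std_pair j).

(** Only the 6 triples of distinct indices contribute. Two-forms commute, so each gives the sign of
    x_0 y_0 x_1 y_1 x_2 y_2 relative to x_0 x_1 x_2 y_0 y_1 y_2, which has three inversions. *)
Lemma sum_det_std_pairs : \sum_i \sum_j \sum_k
  \det (row_mx (row_mx (std_pair i) (std_pair j)) (std_pair k)) = - 6.
Proof.
pose F (i j k r c : nat) : int :=
  (r == nth 0%N [:: i; 3 + i; j; 3 + j; k; 3 + k] c)%N%:Z.
have FE (i j k : 'I_3) :
    \det (row_mx (row_mx (std_pair i) (std_pair j)) (std_pair k)) =
    (det_nat 6 (F i j k))%:~R.
  rewrite -det_natE; congr (\det _); apply/matrixP => r c; rewrite [RHS]mxE.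
  have sp (m : 'I_3) (d : 'I_2) :
      std_pair m r d = (r == nth 0%N [:: (m : nat); (3 + m)%N] d :> nat)%:R.
    by rewrite mxE; case: d => [[|[|//]] /= _].
  case: (split_ordP (c : 'I_((2 + 2) + 2))) => [c' ->|d ->].
    rewrite (row_mxEl (row_mx (std_pair i) (std_pair j)) (std_pair k)).
    case: (split_ordP (c' : 'I_(2 + 2))) => d ->.
      rewrite (row_mxEl (std_pair i) (std_pair j)) sp /F.
      by case: d => [[|[|//]] /= _].
    rewrite (row_mxEr (std_pair i) (std_pair j)) sp /F.
    by case: d => [[|[|//]] /= _].
  rewrite (row_mxEr (row_mx (std_pair i) (std_pair j)) (std_pair k)) sp /F.
  by case: d => [[|[|//]] /= _].
(* The sum over three indices written out, in a form that [vm_compute] evaluates. *)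
pose S (D : nat -> int) : int := D 0%N + (D 1%N + D 2%N).
have SE (D : nat -> int) : \sum_(i < 3) D i = S D.
  by rewrite !big_ord_recl big_ord0 addr0.
transitivity ((\sum_(i < 3) \sum_(j < 3) \sum_(k < 3) det_nat 6 (F i j k))%:~R : R).
  rewrite rmorph_sum; apply: eq_bigr => i _; rewrite rmorph_sum.
  by apply: eq_bigr => j _; rewrite rmorph_sum; apply: eq_bigr => k _; exact: FE.
have -> : \sum_(i < 3) \sum_(j < 3) \sum_(k < 3) det_nat 6 (F i j k) =
    S (fun i => S (fun j => S (fun k => det_nat 6 (F i j k)))).
  rewrite -SE; apply: eq_bigr => i _; rewrite -SE; apply: eq_bigr => j _.
  by rewrite -SE.
suff -> : S (fun i => S (fun j => S (fun k => det_nat 6 (F i j k)))) = - 6 by [].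
by vm_compute.
Qed.

Lemma std_symplectic_cube v :
  wedge (wedge std_symplectic std_symplectic) std_symplectic v = - 6 * \det v.
Proof.
have E p q (A : 'M[R]_(3 + 3, p)) (B : 'M[R]_(3 + 3, q)) u :
    wedge (fun u => \det (u *m A)) (fun u => \det (u *m B)) u =
    \det (u *m row_mx A B).
  rewrite -[in RHS](@map_mx_id _ _ _ idfun _ u) // -[RHS](wedge_det_form idfun).
  by congr (wedge _ _ u); apply/funext => w; rewrite /det_form map_mx_id.
have EE : wedge std_symplectic std_symplectic =
    fun u => \sum_(t : 'I_3 * 'I_3) \det (u *m row_mx (std_pair t.1) (std_pair t.2)).
  apply/funext => u; rewrite wedge_sum pair_big /=; apply: eq_bigr => t _.
  exact: E.
rewrite EE wedge_sum -sum_det_std_pairs [in RHS]pair_big /= mulr_suml.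
apply: eq_bigr => t _; rewrite mulr_suml; apply: eq_bigr => k _.
by rewrite E det_mulmx mulrC.
Qed.

End StandardSymplecticForm.

(** * The SU(3)-structure *)

Section ComplexExpSums.
Variables (R : realType) (n : nat).

Definition cexp_sum (f : 'rV[R]_n -> R[i]) :=
  exp_sum (fun x => complex.Re (f x)) /\ exp_sum (fun x => complex.Im (f x)).

Lemma cexp_sum_cst c : cexp_sum (cst c).
Proof. by split; exact: exp_sum_cst. Qed.

Lemma cexp_sumD f g : cexp_sum f -> cexp_sum g -> cexp_sum (fun x => f x + g x).
Proof.
move=> [f1 f2] [g1 g2]; split.
  have -> : (fun x => complex.Re (f x + g x)) =
      (fun x => complex.Re (f x) + complex.Re (g x)).
    by apply/funext => x; case: (f x) (g x) => ? ? [].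
  exact: exp_sumD.
have -> : (fun x => complex.Im (f x + g x)) =
    (fun x => complex.Im (f x) + complex.Im (g x)).
  by apply/funext => x; case: (f x) (g x) => ? ? [].
exact: exp_sumD.
Qed.

Lemma cexp_sumM f g : cexp_sum f -> cexp_sum g -> cexp_sum (fun x => f x * g x).
Proof.
move=> [f1 f2] [g1 g2]; split.
  have -> : (fun x => complex.Re (f x * g x)) =
      (fun x => complex.Re (f x) * complex.Re (g x) +
        - (complex.Im (f x) * complex.Im (g x))).
    by apply/funext => x; case: (f x) (g x) => ? ? [].
  by apply: exp_sumD; [|apply: exp_sumN]; exact: exp_sumM.
have -> : (fun x => complex.Im (f x * g x)) =
    (fun x => complex.Re (f x) * complex.Im (g x) +
      complex.Im (f x) * complex.Re (g x)).
  by apply/funext => x; case: (f x) (g x) => ? ? [].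
by apply: exp_sumD; exact: exp_sumM.
Qed.

Lemma cexp_sum_det p (A : 'rV[R]_n -> 'M[R[i]]_p) :
  (forall i j, cexp_sum (fun x => A x i j)) -> cexp_sum (fun x => \det (A x)).
Proof.
move=> AE; rewrite /determinant.
elim: (index_enum _) => [|s r IH].
  by under eq_fun do rewrite big_nil; exact: cexp_sum_cst.
under eq_fun do rewrite big_cons; apply: cexp_sumD => //.
apply: cexp_sumM; first exact: cexp_sum_cst.
elim: (index_enum _) => [|i t IHt].
  by under eq_fun do rewrite big_nil; exact: cexp_sum_cst.
by under eq_fun do rewrite big_cons; exact: cexp_sumM.
Qed.

End ComplexExpSums.

Section SolGeometry.
Variable R : realType.

Local Notation X := 'rV[R]_(3 + 3).
Local Notation C := (real_complex R).
Implicit Types (x b : X) (j : 'I_3).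

Definition sol_manifold : smoothManifold R 6 := orbit_manifold (sol_group R).

Lemma mul_sol_linearl m (v : 'M[R]_(m, 3 + 3)) b i j :
  (v *m sol_linear b) i (lshift 3 j) = v i (lshift 3 j) * expR (- wt j b).
Proof. by rewrite mul_mx_diag mxE row_mxEl [X in _ * X]mxE. Qed.

Lemma mul_sol_linearr m (v : 'M[R]_(m, 3 + 3)) b i j :
  (v *m sol_linear b) i (rshift 3 j) = v i (rshift 3 j) * expR (wt j b).
Proof. by rewrite mul_mx_diag mxE row_mxEr [X in _ * X]mxE. Qed.

Definition fiber_scale j : R := if j == 1 then 2^-1 else 1.

Definition frame_re j x : R := expR (wt j x).
Definition frame_im j x : R := fiber_scale j * expR (- wt j x).

Lemma fiber_scale_gt0 j : 0 < fiber_scale j.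
Proof. by rewrite /fiber_scale; case: ifP => _; rewrite ?invr_gt0. Qed.

Lemma frame_re_gt0 j x : 0 < frame_re j x.
Proof. exact: expR_gt0. Qed.

Lemma frame_im_gt0 j x : 0 < frame_im j x.
Proof. by rewrite mulr_gt0 ?expR_gt0 ?fiber_scale_gt0. Qed.

Lemma frame_re_act j b x : frame_re j (sol_act b x) = frame_re j x * expR (wt j b).
Proof. by rewrite /frame_re wt_act expRD. Qed.

Lemma frame_im_act j b x : frame_im j (sol_act b x) = frame_im j x * expR (- wt j b).
Proof. by rewrite /frame_im wt_act opprD expRD mulrA. Qed.

Lemma exp_sum_expN j : exp_sum (fun x : X => expR (- wt j x)).
Proof.
have -> : (fun x : X => expR (- wt j x)) =
    (fun x => expR ((x *m (- weight R j)) 0 0)).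
  by apply/funext => x; rewrite mulmxN mxE.
exact: exp_sum_expR.
Qed.

Lemma exp_sum_frame_re j : exp_sum (frame_re j).
Proof. exact: exp_sum_expR. Qed.

Lemma exp_sum_frame_im j : exp_sum (frame_im j).
Proof. by apply: exp_sumM; [exact: exp_sum_cst|exact: exp_sum_expN]. Qed.

(* The columns are the (1,0)-forms zeta_j = frame_re_j dx_j + i frame_im_j dy_j. *)
Definition coframe x : 'M[R[i]]_(3 + 3, 3) :=
  col_mx (diag_mx (\row_j C (frame_re j x)))
         (diag_mx (\row_j ('i%C * C (frame_im j x)))).

Lemma mul_coframe m (v : 'M[R]_(m, 3 + 3)) x i j :
  (map_mx C v *m coframe x) i j =
  Complex (v i (lshift 3 j) * frame_re j x) (v i (rshift 3 j) * frame_im j x).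
Proof.
rewrite -[in LHS](hsubmxK v) map_row_mx mul_row_col !mul_mx_diag !mxE.
apply/eqP; rewrite eq_complex /=.
by apply/andP; split; apply/eqP; ring.
Qed.

Lemma coframe_act m (v : 'M[R]_(m, 3 + 3)) b x :
  map_mx C (v *m sol_linear b) *m coframe (sol_act b x) = map_mx C v *m coframe x.
Proof.
have e1 j : expR (- wt j b) * expR (wt j b) = 1 by rewrite -expRD addNr expR0.
apply/matrixP => i j; rewrite [LHS]mul_coframe [RHS]mul_coframe.
rewrite mul_sol_linearl mul_sol_linearr frame_re_act frame_im_act.
by rewrite mulrACA e1 mulr1 mulrACA (mulrC (expR (wt j b))) e1 mulr1.
Qed.

Definition sol_psi x : kform R (3 + 3) R[i] 3 :=
  fun v => (1 - 'i%C) * det_form C (coframe x) v.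

Lemma sol_psi_act b x v : sol_psi (sol_act b x) (v *m sol_linear b) = sol_psi x v.
Proof. by rewrite /sol_psi /det_form coframe_act. Qed.

Lemma cexp_sum_sol_psi v : cexp_sum (fun x => sol_psi x v).
Proof.
apply: cexp_sumM; first exact: cexp_sum_cst.
apply: cexp_sum_det => i j.
under eq_fun do rewrite (mul_coframe v).
split => /=; apply: exp_sumM; try exact: exp_sum_cst.
  exact: exp_sum_frame_re.
exact: exp_sum_frame_im.
Qed.

(** The structure J for which zeta_j (J v) = i zeta_j (v) for every j. *)
Definition sol_acs x : 'M[R]_(3 + 3) :=
  block_mx 0 (diag_mx (\row_j (frame_re j x / frame_im j x)))
           (diag_mx (\row_j - (frame_im j x / frame_re j x))) 0.

Lemma mul_sol_acsl m (v : 'M[R]_(m, 3 + 3)) x i j :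
  (v *m sol_acs x) i (lshift 3 j) =
  - (frame_im j x / frame_re j x) * v i (rshift 3 j).
Proof.
rewrite -[in LHS](hsubmxK v) mul_row_block !mulmx0 add0r addr0 row_mxEl.
by rewrite mul_mx_diag !mxE mulrC.
Qed.

Lemma mul_sol_acsr m (v : 'M[R]_(m, 3 + 3)) x i j :
  (v *m sol_acs x) i (rshift 3 j) = frame_re j x / frame_im j x * v i (lshift 3 j).
Proof.
rewrite -[in LHS](hsubmxK v) mul_row_block !mulmx0 add0r addr0 row_mxEr.
by rewrite mul_mx_diag !mxE mulrC.
Qed.

Lemma pair_mxP m (A B : 'M[R]_(m, 3 + 3)) :
  (forall i j, A i (lshift 3 j) = B i (lshift 3 j)) ->
  (forall i j, A i (rshift 3 j) = B i (rshift 3 j)) -> A = B.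
Proof. by move=> l r; apply/matrixP => i k; case: (split_ordP k) => j ->. Qed.

Lemma frame_ratio_act j b x :
  frame_re j (sol_act b x) / frame_im j (sol_act b x) =
  frame_re j x / frame_im j x * (expR (wt j b) * expR (wt j b)).
Proof.
rewrite frame_re_act frame_im_act expRN.
have := frame_im_gt0 j x; have := expR_gt0 (wt j b).
by move=> /lt0r_neq0 ? /lt0r_neq0 ?; field; apply/andP.
Qed.

Lemma sol_acs_act b x :
  sol_acs x *m sol_linear b = sol_linear b *m sol_acs (sol_act b x).
Proof.
have rE j := frame_ratio_act j b x.
have rE' j : frame_im j (sol_act b x) / frame_re j (sol_act b x) =
    frame_im j x / frame_re j x * (expR (- wt j b) * expR (- wt j b)).
  by rewrite -[LHS]invf_div rE [LHS]invfM invf_div invfM -!expRN.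
have e1 j : expR (- wt j b) * expR (wt j b) = 1 by rewrite -expRD addNr expR0.
rewrite -[sol_acs x]mul1mx -[in RHS](mul1mx (sol_linear b)).
apply: pair_mxP => i j.
  rewrite [LHS]mul_sol_linearl [RHS]mul_sol_acsl [X in X * _ = _]mul_sol_acsl.
  rewrite [X in _ = _ * X]mul_sol_linearr rE'.
  by rewrite -[LHS]mulr1 -(e1 j); ring.
rewrite [LHS]mul_sol_linearr [RHS]mul_sol_acsr [X in X * _ = _]mul_sol_acsr.
rewrite [X in _ = _ * X]mul_sol_linearl rE.
by rewrite -[LHS]mulr1 -(e1 j); ring.
Qed.

Lemma sol_acs_sqr x : sol_acs x *m sol_acs x = - 1%:M.
Proof.
have re0 j : frame_re j x != 0 by rewrite gt_eqF // frame_re_gt0.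
have im0 j : frame_im j x != 0 by rewrite gt_eqF // frame_im_gt0.
rewrite -[X in X *m _]mul1mx; apply: pair_mxP => i j.
  rewrite [LHS]mul_sol_acsl [X in _ * X]mul_sol_acsr [RHS]mxE.
  by field; rewrite re0 im0.
rewrite [LHS]mul_sol_acsr [X in _ * X]mul_sol_acsl [RHS]mxE.
by field; rewrite re0 im0.
Qed.

(** The quotients of frame coefficients are again constants times exponentials, because [frame_re]
    and [frame_im] have opposite exponents. *)
Lemma exp_sum_sol_acs k l : exp_sum (fun x => sol_acs x k l).
Proof.
have fs0 j : fiber_scale j != 0 by rewrite gt_eqF // fiber_scale_gt0.
have acs1 x : sol_acs x k l = (1%:M *m sol_acs x) k l by rewrite mul1mx.
under eq_fun do rewrite acs1; have [j ->|j ->] := split_ordP l.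
  under eq_fun do rewrite mul_sol_acsl.
  apply: exp_sumM; last exact: exp_sum_cst.
  have -> : (fun x => - (frame_im j x / frame_re j x)) =
      (fun x => - (fiber_scale j * (expR (- wt j x) * expR (- wt j x)))).
    by apply/funext => x; rewrite /frame_im /frame_re -expRN mulrA.
  apply: exp_sumN; apply: exp_sumM; first exact: exp_sum_cst.
  by apply: exp_sumM; exact: exp_sum_expN.
under eq_fun do rewrite mul_sol_acsr.
apply: exp_sumM; last exact: exp_sum_cst.
have -> : (fun x => frame_re j x / frame_im j x) =
    (fun x => (fiber_scale j)^-1 * (frame_re j x * frame_re j x)).
  apply/funext => x; rewrite /frame_im expRN -/(frame_re j x).
  by field; rewrite fs0 gt_eqF // frame_re_gt0.
apply: exp_sumM; first exact: exp_sum_cst.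
by apply: exp_sumM; exact: exp_sum_frame_re.
Qed.

Lemma std_symplecticE (v : 'M[R]_(2, 3 + 3)) : std_symplectic v =
  \sum_j (v 0 (lshift 3 j) * v 1 (rshift 3 j) - v 0 (rshift 3 j) * v 1 (lshift 3 j)).
Proof. by apply: eq_bigr => j _; exact: det_coord_pair. Qed.

Lemma std_symplectic_col (u v : X) : std_symplectic (col_mx u v) =
  \sum_j (u 0 (lshift 3 j) * v 0 (rshift 3 j) - u 0 (rshift 3 j) * v 0 (lshift 3 j)).
Proof.
rewrite std_symplecticE; apply: eq_bigr => j _.
have -> : 0 = lshift 1 (0 : 'I_1) :> 'I_(1 + 1) by exact/val_inj.
have -> : 1 = rshift 1 (0 : 'I_1) :> 'I_(1 + 1) by exact/val_inj.
by rewrite !(col_mxEu u v, col_mxEd u v).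
Qed.

Lemma std_symplectic_act b (v : 'M[R]_(2, 3 + 3)) :
  std_symplectic (v *m sol_linear b) = std_symplectic v.
Proof.
rewrite !std_symplecticE; apply: eq_bigr => j _.
rewrite !mul_sol_linearl !mul_sol_linearr.
have e1 : expR (- wt j b) * expR (wt j b) = 1 by rewrite -expRD addNr expR0.
by rewrite -[RHS]mulr1 -e1; ring.
Qed.

Lemma sol_metricE x (u v : X) : std_symplectic (col_mx u (v *m sol_acs x)) =
  \sum_j (frame_re j x / frame_im j x * (u 0 (lshift 3 j) * v 0 (lshift 3 j)) +
    frame_im j x / frame_re j x * (u 0 (rshift 3 j) * v 0 (rshift 3 j))).
Proof.
rewrite std_symplectic_col; apply: eq_bigr => j _.
by rewrite mul_sol_acsl mul_sol_acsr; ring.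
Qed.

End SolGeometry.

(** * Volume normalization and type of psi *)

Section SolVolume.
Variable R : realType.

Local Notation X := 'rV[R]_(3 + 3).
Local Notation C := (real_complex R).
Implicit Types (x b : X) (j : 'I_3).

Lemma sol_psi_conj x v : (sol_psi x v)^*%C =
  (1 + 'i%C) * det_form C (map_mx conjc (coframe x)) v.
Proof.
rewrite /sol_psi /det_form rmorphM /= -det_map_mx map_mxM -map_mx_comp.
rewrite (_ : _ \o _ = C) ?rmorphB ?rmorph1 /=; last first.
  by apply/funext => r /=; exact: conjc_real.
by congr (_ * _); apply/eqP; rewrite eq_complex /=; apply/andP; split; apply/eqP; ring.
Qed.

Lemma frame_reM_im j x : frame_re j x * frame_im j x = fiber_scale R j.
Proof. by rewrite /frame_re /frame_im mulrCA -expRD subrr expR0 mulr1. Qed.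

(** Subtracting each zeta_j from its conjugate makes the matrix block triangular, with determinant
    (-2i)^3 times the product of the fiber scales, that is, 8i / 2. *)
Lemma det_coframe_conj x :
  \det (row_mx (coframe x) (map_mx conjc (coframe x))) = 4 * 'i%C.
Proof.
pose DA := diag_mx (\row_j C (frame_re j x)).
pose DB := diag_mx (\row_j ('i%C * C (frame_im j x))).
pose D2 := diag_mx (\row_j (- 2 * ('i%C * C (frame_im j x)))).
have -> : row_mx (coframe x) (map_mx conjc (coframe x)) =
    block_mx DA 0 DB 1%:M *m block_mx 1%:M 1%:M 0 D2.
  have -> : map_mx conjc (coframe x) = col_mx DA (DB + D2).
    rewrite /coframe map_col_mx; congr col_mx; apply/matrixP => i j; rewrite !mxE.
      by case: eqP => _; rewrite ?mulr1n ?mulr0n ?conjc_real ?rmorph0.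
    case: eqP => _; rewrite ?mulr1n ?mulr0n ?addr0 ?rmorph0 //.
    apply/eqP; rewrite eq_complex /=.
    by apply/andP; split; apply/eqP; ring.
  rewrite -block_mxEh mulmx_block.
  by rewrite !mulmx1 !mulmx0 !mul0mx !mul1mx !addr0.
rewrite det_mulmx det_lblock det_ublock !det1 mulr1 mul1r !det_diag -big_split /=.
rewrite !big_ord_recl big_ord0 !mxE.
have e j : C (frame_re j x) * (- 2 * ('i%C * C (frame_im j x))) =
    - 2 * 'i%C * C (fiber_scale R j).
  by rewrite -(frame_reM_im j x) [in RHS]rmorphM /=; ring.
rewrite !e /fiber_scale /= fmorphV rmorph1 rmorph_nat.
have i2 : 'i%C * 'i%C = -1 :> R[i] by rewrite -expr2 sqr_i.
transitivity (- 4 * ('i%C * 'i%C) * 'i%C : R[i]); first by field.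
by rewrite i2; ring.
Qed.

(** Both sides are 8i det v: on the left |1 - i|^2 times 4i, on the right - (4/3) i times - 6. *)
Lemma sol_volume x v :
  wedge (sol_psi x) (fun u => (sol_psi x u)^*%C) v =
  - (4 / 3) * 'i%C * (wedge (wedge (@std_symplectic R) (@std_symplectic R))
    (@std_symplectic R) v)%:C%C.
Proof.
have -> : (fun u => (sol_psi x u)^*%C) = (fun u => (1 + 'i%C) *
    det_form C (map_mx conjc (coframe x)) u).
  by apply/funext => u; exact: sol_psi_conj.
rewrite [LHS]wedgeZ wedge_det_form /det_form det_mulmx det_coframe_conj.
rewrite det_map_mx std_symplectic_cube rmorphM /= rmorphN rmorph_nat.
have i2 : 'i%C * 'i%C = -1 :> R[i] by rewrite -expr2 sqr_i.
have -> : (1 - 'i%C) * (1 + 'i%C) = 1 - 'i%C * 'i%C :> R[i] by ring.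
by rewrite i2; field.
Qed.

Lemma sol_psi_type x : type_k0 (sol_acs x) (sol_psi x).
Proof.
move=> v j; set v' := \matrix_(l < 3) _.
have re0 k : frame_re k x != 0 by rewrite gt_eqF // frame_re_gt0.
have im0 k : frame_im k x != 0 by rewrite gt_eqF // frame_im_gt0.
have i2 : 'i%C * 'i%C = -1 :> R[i] by rewrite -expr2 sqr_i.
suff detE : \det (map_mx C v' *m coframe x) = 'i%C * \det (map_mx C v *m coframe x).
  by rewrite /sol_psi /det_form detE mulrCA [X in _ + _ * X]mulrA i2 mulN1r mulrN subrr.
(* A zero second summand lets multilinearity of the determinant pull the factor i out of row [j]. *)
rewrite -[RHS]addr0 -[X in _ + X](mul0r (\det (map_mx C v *m coframe x))).
apply: (determinant_multilinear (i0 := j)).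
- rewrite scale0r addr0; apply/rowP => k; rewrite [LHS]mxE [RHS]mxE [in RHS]mxE.
  rewrite [LHS]mul_coframe [X in _ = _ * X]mul_coframe.
  have v'j l : v' j l = (row j v *m sol_acs x) 0 l by rewrite mxE eqxx.
  rewrite !v'j mul_sol_acsl mul_sol_acsr !mxE.
  apply/eqP; rewrite eq_complex /=; apply/andP; split; apply/eqP.
    by field.
  by field.
- apply/matrixP => a b; rewrite !mxE; apply: eq_bigr => c _; rewrite !mxE.
  by rewrite eq_sym (negPf (neq_lift _ _)) !mxE.
- apply/matrixP => a b; rewrite !mxE; apply: eq_bigr => c _; rewrite !mxE.
  by rewrite eq_sym (negPf (neq_lift _ _)) !mxE.
Qed.

Lemma sol_psi_neq0 x : exists v, sol_psi x v != 0.
Proof.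
exists (row_mx 1%:M 0); rewrite /sol_psi mulf_neq0 //.
  by rewrite eq_complex /= subr0 oner_eq0.
rewrite /det_form map_row_mx map_mx1 map_mx0 mul_row_col mul1mx mul0mx addr0.
rewrite det_diag; apply/prodf_neq0 => j _; rewrite mxE eq_complex /=.
by rewrite gt_eqF // frame_re_gt0.
Qed.

End SolVolume.

(** * The invariant primitive of Re psi *)

Section SolPrimitive.
Variable R : realType.

Local Notation X := 'rV[R]_(3 + 3).
Local Notation C := (real_complex R).
Implicit Types (x b : X) (j : 'I_3).

(** With a_j = e^w dx_j and b_j = e^-w dy_j, w the weight of pair j, Re psi is (dt + ds) /\ (a_1 a_2
    - b_1 b_2 / 2) + (dt - ds) /\ (a_1 b_2 + b_1 a_2 / 2). Now d multiplies b_1 b_2 by - (dt + ds)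
    and b_1 a_2 by ds - dt, which flips the signs of their two coefficients. *)
Definition sol_primitive_terms : seq (R * 'cV[R]_(3 + 3) * 'M[R]_(3 + 3, 2)) :=
  let: (x1, y1) := (lshift 3 1, rshift 3 1) : 'I_(3 + 3) * 'I_(3 + 3) in
  let: (x2, y2) := (lshift 3 2, rshift 3 2) : 'I_(3 + 3) * 'I_(3 + 3) in
  [:: (1, weight R 1 + weight R 2, coord_pair R x1 x2);
      (1, weight R 1 - weight R 2, coord_pair R x1 y2);
      (- 2^-1, weight R 2 - weight R 1, coord_pair R y1 x2);
      (2^-1, - weight R 1 - weight R 2, coord_pair R y1 y2)].

Lemma sol_primitive_act b x v :
  exp_det_form sol_primitive_terms (sol_act b x) (v *m sol_linear b) =
  exp_det_form sol_primitive_terms x v.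
Proof.
have wtD l l' (y : X) : (y *m (l + l')) 0 0 = (y *m l) 0 0 + (y *m l') 0 0 :> R.
  by rewrite mulmxDr mxE.
have wtN l (y : X) : (y *m - l) 0 0 = - (y *m l) 0 0 :> R.
  by rewrite mulmxN mxE.
rewrite /exp_det_form !big_cons !big_nil /= !det_coord_pair.
rewrite !mul_sol_linearl !mul_sol_linearr !(wtD, wtN) -!/(wt _ _) !wt_act.
rewrite !(opprD, expRD) !expRN.
have := expR_gt0 (wt 1 b); have := expR_gt0 (wt 2 b).
have := expR_gt0 (wt 1 x); have := expR_gt0 (wt 2 x).
move=> /lt0r_neq0 ? /lt0r_neq0 ? /lt0r_neq0 ? /lt0r_neq0 ?.
field; do ?[apply/andP; split => //].
Qed.

Lemma det_row_mx3 n (l : 'cV[R]_n) (A : 'M[R]_(n, 2)) (v : 'M[R]_(3, n)) :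
  \det (v *m (row_mx l A : 'M[R]_(n, 1 + 2))) =
  (v *m l) 0 0 * ((v *m A) 1 0 * (v *m A) 2 1 - (v *m A) 1 1 * (v *m A) 2 0)
  - (v *m l) 1 0 * ((v *m A) 0 0 * (v *m A) 2 1 - (v *m A) 0 1 * (v *m A) 2 0)
  + (v *m l) 2 0 * ((v *m A) 0 0 * (v *m A) 1 1 - (v *m A) 0 1 * (v *m A) 1 0).
Proof.
rewrite det_mx33; set B := v *m row_mx l A.
have B0 i : B i 0 = (v *m l) i 0.
  by rewrite !mxE; apply: eq_bigr => k _; rewrite (row_mx_col0 l A).
have B1 i : B i 1 = (v *m A) i 0.
  rewrite !mxE; apply: eq_bigr => k _; rewrite -(row_mx_lift0 l A).
  by congr (_ * row_mx l A k _); exact/val_inj.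
have B2 i : B i 2 = (v *m A) i 1.
  rewrite !mxE; apply: eq_bigr => k _; rewrite -(row_mx_lift0 l A).
  by congr (_ * row_mx l A k _); exact/val_inj.
by rewrite !(B0, B1, B2); ring.
Qed.

Lemma Re_sol_psi x v :
  complex.Re (sol_psi x v) = exp_det_form (d_terms sol_primitive_terms) x v.
Proof.
have wtD l l' (y : X) : (y *m (l + l')) 0 0 = (y *m l) 0 0 + (y *m l') 0 0 :> R.
  by rewrite mulmxDr mxE.
have wtN l (y : X) : (y *m - l) 0 0 = - (y *m l) 0 0 :> R.
  by rewrite mulmxN mxE.
have vD l l' i : (v *m (l + l')) i 0 = (v *m l) i 0 + (v *m l') i 0.
  by rewrite mulmxDr mxE.
have vN l i : (v *m - l) i 0 = - (v *m l) i 0 by rewrite mulmxN mxE.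
have w1 i : (v *m weight R 1) i 0 = v i (lshift 3 0).
  by rewrite /weight /= -colE mxE.
have w2 i : (v *m weight R 2) i 0 = v i (rshift 3 0).
  by rewrite /weight /= -colE mxE.
rewrite /exp_det_form /d_terms /= !big_cons !big_nil /= !det_row_mx3.
rewrite !mulmx_coord_pair /= !(wtD, wtN, vD, vN, w1, w2) -!/(wt _ _).
rewrite !(opprD, expRD) /sol_psi /det_form det_mx33 !mul_coframe.
have f0 : frame_re 0 x = 1 by rewrite /frame_re wtE expR0.
have g0 : frame_im 0 x = 1 by rewrite /frame_im /fiber_scale wtE /= oppr0 expR0 mulr1.
have g1 : frame_im 1 x = 2^-1 * expR (- wt 1 x) by [].
have g2 : frame_im 2 x = expR (- wt 2 x) by rewrite /frame_im /fiber_scale mul1r.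
rewrite f0 g0 g1 g2 /frame_re /=.
by field.
Qed.

End SolPrimitive.

(** * Verification of the axioms on the quotient *)

Section SolStructure.
Variable R : realType.

Local Notation M := (sol_manifold R).

Definition sol_form k (a : 'rV[R]_(3 + 3) -> kform R (3 + 3) R k) : local_form M R k :=
  fun _ => a.

Lemma diff_form_exp_det p (s : seq (R * 'cV[R]_(3 + 3) * 'M[R]_(3 + 3, p))) :
  (forall b x v,
    exp_det_form s (sol_act b x) (v *m sol_linear b) = exp_det_form s x v) ->
  diff_form (sol_form (exp_det_form s)).
Proof.
move=> sG; apply: (@diff_form_invariant R (3 + 3) (sol_group R)) => [x|x|v|b x v _].
- exact: multilinear_exp_det_form.
- exact: alternate_exp_det_form.
- exact: exp_sum_exp_det_form.
- exact: sG.
Qed.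

Lemma diff_form_symplectic : diff_form (sol_form (fun=> @std_symplectic R)).
Proof.
apply: (@diff_form_invariant R (3 + 3) (sol_group R)) => [x|x|v|b x v _].
- move=> v u w i b c vE uE wE; rewrite /std_symplectic !mulr_sumr -big_split /=.
  by apply: eq_bigr => j _; exact: multilinear_det vE uE wE.
- by move=> v i j ij vij; apply: big1 => k _; exact: alternate_det ij vij.
- exact: exp_sum_cst.
- exact: std_symplectic_act.
Qed.

(** Pairing [u] with the basis vector of the partner coordinate isolates one coordinate of [u], up
    to sign. *)
Lemma std_symplectic_nondegenerate (u : 'rV[R]_(3 + 3)) :
  (forall v : 'rV[R]_(3 + 3), std_symplectic (col_mx u v) = 0) -> u = 0.
Proof.
move=> u0; apply: pair_coordP => j; rewrite mxE.
  have := u0 (delta_mx 0 (rshift 3 j)); rewrite std_symplectic_col (bigD1 j) //=.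
  rewrite big1 ?addr0 => [|k kj]; rewrite !mxE eq_lrshift ?eqxx ?mulr0 ?subr0 ?mulr1 //.
  by rewrite (inj_eq (@rshift_inj _ _)) (negPf kj) mulr0.
have := u0 (delta_mx 0 (lshift 3 j)); rewrite std_symplectic_col (bigD1 j) //=.
rewrite big1 ?addr0 => [|k kj]; rewrite !mxE eq_rlshift ?eqxx ?mulr0 ?sub0r ?mulr1.
  by move/eqP; rewrite oppr_eq0 => /eqP.
by rewrite (inj_eq (@lshift_inj _ _)) (negPf kj) mulr0 oppr0.
Qed.

Lemma sol_calibrated (x : 'rV[R]_(3 + 3)) :
  let g (u v : 'rV[R]_(3 + 3)) := std_symplectic (col_mx u (v *m sol_acs x)) in
  [/\ forall u v, g u v = g v u,
      forall u, u != 0 -> 0 < g u u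
    & forall u v, g (u *m sol_acs x) (v *m sol_acs x) = g u v].
Proof.
move=> g; rewrite /g.
have q0 j : 0 < frame_re j x / frame_im j x.
  by rewrite divr_gt0 ?frame_re_gt0 ?frame_im_gt0.
have r0 j : 0 < frame_im j x / frame_re j x.
  by rewrite divr_gt0 ?frame_re_gt0 ?frame_im_gt0.
split=> [u v|u un0|u v].
- by rewrite !sol_metricE; apply: eq_bigr => j _; congr (_ * _ + _ * _); exact: mulrC.
- pose F j : R := frame_re j x / frame_im j x * (u 0 (lshift 3 j) * u 0 (lshift 3 j)) +
    frame_im j x / frame_re j x * (u 0 (rshift 3 j) * u 0 (rshift 3 j)).
  have -> : std_symplectic (col_mx u (u *m sol_acs x)) = \sum_j F j.
    exact: sol_metricE.
  rewrite lt_def.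
  have F0 j : 0 <= F j.
    by rewrite addr_ge0 // mulr_ge0 ?(ltW (q0 j)) ?(ltW (r0 j)) // -expr2 sqr_ge0.
  rewrite (sumr_ge0 _ (fun j _ => F0 j)) andbT.
  have pos2 (q r a b : R) : 0 < q -> 0 < r -> q * (a * a) + r * (b * b) = 0 ->
      a = 0 /\ b = 0.
    move=> q_gt0 r_gt0 /eqP.
    rewrite paddr_eq0; try by rewrite mulr_ge0 ?(ltW q_gt0) ?(ltW r_gt0) // -expr2 sqr_ge0.
    by rewrite !mulf_eq0 (gt_eqF q_gt0) (gt_eqF r_gt0) !orbb => /andP[/eqP-> /eqP->].
  apply: contra un0 => /eqP/psumr_eq0P F_0; apply/eqP/pair_coordP => j; rewrite mxE;
    by have [] := pos2 _ _ _ _ (q0 j) (r0 j) (F_0 (fun j _ => F0 j) j isT).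
- rewrite !sol_metricE; apply: eq_bigr => j _.
  have re0 : frame_re j x != 0 by rewrite gt_eqF // frame_re_gt0.
  have im0 : frame_im j x != 0 by rewrite gt_eqF // frame_im_gt0.
  rewrite !(mul_sol_acsl u, mul_sol_acsl v, mul_sol_acsr u, mul_sol_acsr v).
  by field; rewrite re0 im0.
Qed.

Lemma sol_almost_complex :
  @almost_complex R 6 M (fun _ => @sol_acs R).
Proof.
split=> [i a b|i j x /orbit_overlap[b [_ -> ->]]|i x _].
- exact/exp_sum_smooth/exp_sum_sol_acs.
- exact: sol_acs_act.
- exact: sol_acs_sqr.
Qed.

(** Multilinearity is proved once for the complex form; its coefficients b and c are real, so it
    passes to the real and imaginary parts. *)
Lemma diff_form_sol_psi :
  complex_diff_form (fun (_ : atlas_index M) => @sol_psi R).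
Proof.
have psiM x v u w i b c : row i v = b *: row i u + c *: row i w ->
    row' i u = row' i v -> row' i w = row' i v ->
    @sol_psi R x v = b%:C%C * sol_psi x u + c%:C%C * sol_psi x w.
  move=> vE uE wE; rewrite /sol_psi /det_form.
  rewrite (determinant_multilinear (i0 := i) (B := map_mx (real_complex R) u *m coframe x)
    (C := map_mx (real_complex R) w *m coframe x) (b := b%:C%C) (c := c%:C%C)).
  - by rewrite mulrDr !(mulrCA (1 - 'i%C)).
  - by rewrite !row_mul -!map_row vE map_mxD !map_mxZ mulmxDl !scalemxAl.
  - by rewrite !row'_mul -!map_row' uE.
  - by rewrite !row'_mul -!map_row' wE.
have psiA x v i j : i != j -> row i v = row j v -> @sol_psi R x v = 0.
  move=> ij vij; rewrite /sol_psi /det_form (determinant_alternate ij) ?mulr0 // => k.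
  rewrite !mul_coframe; have vE l : v i l = v j l.
    by move/rowP/(_ l): vij; rewrite !mxE.
  by rewrite !vE.
split; apply: (@diff_form_invariant R (3 + 3) (sol_group R)) => [x|x|v|b x v _].
- move=> v u w i b c vE uE wE; rewrite (psiM x v u w i b c) //.
  by case: (sol_psi x u) (sol_psi x w) => ? ? [? ?] /=; ring.
- by move=> v i j ij vij; rewrite (psiA x v i j).
- by have [] := cexp_sum_sol_psi v.
- by rewrite sol_psi_act.
- move=> v u w i b c vE uE wE; rewrite (psiM x v u w i b c) //.
  by case: (sol_psi x u) (sol_psi x w) => ? ? [? ?] /=; ring.
- by move=> v i j ij vij; rewrite (psiA x v i j).
- by have [] := cexp_sum_sol_psi v.
- by rewrite sol_psi_act.
Qed.

End SolStructure.

Theorem theorem3p5 (R : realType) :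
  exists M : smoothManifold R 6,
    [/\ [set: M] !=set0, compact [set: M]
      & exists (w : local_form M R 2)
               (J : atlas_index M -> 'rV[R]_6 -> 'M[R]_6)
               (psi : local_form M R[i] 3),
          symplectic_half_flat w J psi /\ exact_form (re_form psi)].
Proof.
have rePsi : re_form (fun _ : atlas_index (sol_manifold R) => @sol_psi R) =
    fun _ => exp_det_form (d_terms (sol_primitive_terms R)).
  by apply/funext => i; apply/funext => x; apply/funext => v; exact: Re_sol_psi.
exists (sol_manifold R); split.
- by exists (orbit_proj (sol_group R) 0).
- exact: orbit_space_compact.
exists (fun _ _ => @std_symplectic R), (fun _ => @sol_acs R), (fun _ => @sol_psi R).
split; last first.
  rewrite rePsi; exists (fun _ => exp_det_form (sol_primitive_terms R)).
    by apply: diff_form_exp_det => b x v; exact: sol_primitive_act.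
  by move=> i x v _; rewrite ext_d_exp_det_form.
split.
- split.
  + split; first exact: diff_form_symplectic.
    by move=> i x u _; exact: std_symplectic_nondegenerate.
  + by split; [exact: sol_almost_complex|move=> i x _; exact: sol_calibrated].
  + by split; [exact: diff_form_sol_psi|move=> i x _; exact: sol_psi_neq0].
  + by move=> i x _; exact: sol_psi_type.
  + by move=> i x v _; exact: sol_volume.
- move=> i x v _; rewrite /ext_d; apply: big1 => j _.
  by rewrite derive_cst mulr0.
(* Re psi is already written as the differential of the primitive, so its closedness is d d = 0. *)
- move=> i x v _; rewrite rePsi ext_d_exp_det_form.
  exact: ext_d2_exp_det_form.
Qed.
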